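(* Let $(\mathcal{Y},T,\nu)$, $(\mathcal{X},S)$ and $\ell:\mathcal{X}\times\mathcal{Y}\to\mathbb{R}$ satisfy the standard assumptions. Then for $\nu$-almost every $y\in\mathcal{Y}$, $$\lim_{n\to\infty}\ \inf_{x\in\mathcal{X}}\ \frac1n\sum_{k=0}^{n-1}\ell(S^kx,T^ky)\ =\ \inf_{\lambda\in\mathcal{J}(S:\nu)}\int \ell\,d\lambda\ =:\ L(S:\nu)$$ (in particular the limit exists). The infimum over $\lambda \in \mathcal{J}(S:\nu)$ is finite, and is attained by some $\lambda\in\mathcal{J}(S:\nu)$.
   Context: Standard assumptions: (i) $\mathcal{Y}$ is a non-empty Polish space, $T:\mathcal{Y}\to\mathcal{Y}$ is Borel measurable, and $\nu$ is a Borel probability measure on $\mathcal{Y}$ that is invariant and ergodic under $T$; (ii) $\mathcal{X}$ is a non-empty compact metric space and $S:\mathcal{X}\to\mathcal{X}$ is continuous; (iii) $\ell:\mathcal{X}\times\mathcal{Y}\to\mathbb{R}$ is lower semicontinuous and there is $\ell^*\in L^1(\nu)$ with $\sup_{x\in\mathcal{X}}|\ell(x,y)|\le \ell^*(y)$ for all $y\in\mathcal{Y}$. $S\times T$ is the map $(x,y)\mapsto(Sx,Ty)$ on $\mathcal{X}\times\mathcal{Y}$. $\mathcal{J}(S:\nu)$ denotes the set of all Borel probability measures $\lambda$ on $\mathcal{X}\times\mathcal{Y}$ that are invariant under $S\times T$ and whose $\mathcal{Y}$-marginal is $\nu$ (equivalently, the union over all $S$-invariant Borel probability measures $\mu$ on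 $\mathcal{X}$ of the set of joinings of $(\mathcal{X},S,\mu)$ and $(\mathcal{Y},T,\nu)$, a joining being an $S\times T$-invariant coupling of $\mu$ and $\nu$). *)

(* Defs.v *)
From HB Require Import structures.
From mathcomp Require Import all_boot all_order all_algebra.
From mathcomp Require Import all_classical all_reals all_analysis.

Set Implicit Arguments.
Unset Strict Implicit.
Unset Printing Implicit Defensive.

Import Order.TTheory GRing.Theory Num.Theory.
Import numFieldNormedType.Exports.

Local Open Scope classical_set_scope.
Local Open Scope ring_scope.

(* [Pointed] carries non-emptiness, as everywhere in the library (in
   particular [measurableType]s are pointed). *)
#[short(type="pmetricType")]
HB.structure Definition PointedMetric (K : numDomainType) :=
  {M of Metric K M & isPointed M}.

#[short(type="completeMetricType")]
HB.structure Definition CompleteMetric (K : numDomainType) :=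
  {M of Metric K M & Complete M}.

Definition separable (T : topologicalType) : Prop :=
  exists2 D : set T, countable D & dense D.

Definition completely_metrizable (R : realType) (T : topologicalType) : Prop :=
  exists (M : completeMetricType R) (f : T -> M) (g : M -> T),
    [/\ cancel f g, cancel g f, continuous f & continuous g].

(* Only the topology of [T] is fixed; the complete metric is not. *)
Definition polish (R : realType) (T : topologicalType) : Prop :=
  separable T /\ completely_metrizable R T.

(* On a product [X * Y] this is the sigma-algebra generated by the open sets of
   the product topology, not the library's product sigma-algebra (the two agree
   when X and Y are second countable). *)
Notation borel T := (g_sigma_algebraType (@open T)).

(* [pushforward mu f = mu] would be too strong: it also compares the values
   that [mu] takes on non-measurable sets. *)
Definition invariant_measure d (T : measurableType d) (R : realType)
    (f : T -> T) (mu : set T -> \bar R) : Prop :=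
  forall A, measurable A -> mu (f @^-1` A) = mu A.

Definition ergodic d (T : measurableType d) (R : realType)
    (f : T -> T) (mu : set T -> \bar R) : Prop :=
  forall A, measurable A -> f @^-1` A = A -> mu A = 0%E \/ mu A = 1%E.

Definition prod_map (X Y : Type) (S : X -> X) (T : Y -> Y) (z : X * Y) : X * Y :=
  (S z.1, T z.2).

Section joinings.
Context {R : realType} {X Y : ptopologicalType}.
Variables (S : X -> X) (T : Y -> Y) (nu : probability (borel Y) R).

Definition joinings : set (probability (borel (X * Y)%type) R) :=
  [set lam | invariant_measure (prod_map S T : borel (X * Y)%type -> borel (X * Y)%type) lam
    /\ forall B : set (borel Y), measurable B ->
         lam [set z | B z.2] = nu B].

Definition inf_joinings (l : X * Y -> R) : \bar R :=
  ereal_inf [set (\int[lam]_z (l z)%:E)%E | lam in joinings].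

End joinings.

Section averages.
Context {R : realType} {X Y : Type}.
Variables (S : X -> X) (T : Y -> Y) (l : X * Y -> R).

Definition ergodic_average (n : nat) (x : X) (y : Y) : R :=
  n%:R^-1 * \sum_(k < n) l (iter k S x, iter k T y).

Definition inf_average (n : nat) (y : Y) : \bar R :=
  ereal_inf [set (ergodic_average n x y)%:E | x in [set: X]].

End averages.

(* Main.v *)
Require Import Defs.
From HB Require Import structures.
From mathcomp Require Import all_boot all_order all_algebra.
From mathcomp Require Import all_classical all_reals all_analysis.
From mathcomp Require Import measurable_realfun.
From mathcomp Require finmap.
From mathcomp Require Import lra.

Set Implicit Arguments.
Unset Strict Implicit.
Unset Printing Implicit Defensive.

Import Order.TTheory GRing.Theory Num.Theory.
Import numFieldNormedType.Exports.

Local Open Scope classical_set_scope.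
Local Open Scope ring_scope.

(** Let [u n y] be the infimum over [x] of the Birkhoff sum of length [n] of [l]
    at [(x, y)]. The theorem says that [u n y / n] tends almost surely to the
    least integral of [l] over the joinings.

    The upper bound. Let [lam] be a joining and let [a] exceed its integral of
    [l]. Since [u] is superadditive, the set of [y] at which [u n y - n a] is
    unbounded above is subinvariant under [T], hence null or of full measure. In
    the second case [lam]-almost every [(x, y)] has a positive Birkhoff sum of
    [l - a], because [u n y] is at most the Birkhoff sum of [l] at [(x, y)], and
    the maximal ergodic theorem [maximal_ergodic] gives [lam] an integral of [l]
    at least [a], a contradiction. This is [ae_linear_bound]; applied to [Y]
    itself it also yields the pointwise ergodic theorem [ergodic_theorem] for
    [nu]. Superlevel sets of [u n] are measurable because [X] is compact
    ([measurable_infimal_sum]).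

    The lower bound and the existence of a minimiser. Fix a [y] that is generic
    for [lstar] and for the indicators of a countable algebra [B0] of Borel sets
    that contains a base, and choose near minimisers [x n] of the sums of length
    [n]. Along an ultrafilter the visit frequencies of the orbit segments
    starting at [(x n, y)] converge for all subsets of [X * Y] at once, and the
    limit is a finitely additive probability, exactly invariant, with marginal
    [nu] on [B0]. There is a Borel probability below this mean on countable
    unions of rectangles [V `*` B] with [V] open and [B] in [B0]
    ([measure_of_mean], [borel_measure_of_mean]): on the Cantor space, which maps
    onto [X], a mean with a countably additive [Y]-marginal is countably additive
    on cylinders, and Caratheodory's theorem applies. The measure is a joining
    ([joining_of_mean]). Superlevel sets of the nonnegative function [l + lstar]
    are such countable unions, by semicontinuity, so its integral is at most the
    limit of its averages along the orbit segments ([joining_of_orbit]).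
    Ultrafilters that contain a set of times at which the averages are too small
    give the lower bound, and any ultrafilter gives a joining whose integral is
    minimal. *)

(** * The maximal ergodic theorem *)

Lemma measurable_superlevel d (Z : measurableType d) (R : realType)
    (h : Z -> R) (a : R) :
  measurable_fun [set: Z] h -> measurable [set z | a < h z].
Proof.
by move=> mh; rewrite -preimage_itvoy -[X in measurable X]setTI; exact: mh.
Qed.

Lemma integral_measure_preserving d1 d2 (Z : measurableType d1)
    (W : measurableType d2) (R : realType) (P : {measure set Z -> \bar R})
    (Q : {measure set W -> \bar R}) (phi : Z -> W) (f : W -> \bar R) :
  measurable_fun [set: Z] phi ->
  (forall A, measurable A -> P (phi @^-1` A) = Q A) ->
  Q.-integrable [set: W] f ->
  P.-integrable [set: Z] (f \o phi) /\
  (\int[P]_z f (phi z) = \int[Q]_w f w)%E.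
Proof.
move=> mphi PQ intf; have mf := measurable_int _ intf.
have eqPQ g : (\int[Q]_w g w = \int[pushforward P phi]_w g w)%E.
  by apply: eq_measure_integral => A mA _; rewrite /= /pushforward PQ.
have intfphi : P.-integrable [set: Z] (f \o phi).
  apply/integrableP; split; first exact: (measurableT_comp mf mphi).
  have := integrableP _ _ _ intf => -[_].
  by rewrite eqPQ ge0_integral_pushforward//; exact: measurableT_comp.
by split => //; rewrite eqPQ integral_pushforward.
Qed.

Definition birkhoff_sum (Z : Type) (R : realType) (f : Z -> Z) (g : Z -> R)
  (n : nat) (z : Z) : R := \sum_(k < n) g (iter k f z).

Lemma birkhoff_sum0 (Z : Type) (R : realType) (f : Z -> Z) (g : Z -> R) z :
  birkhoff_sum f g 0 z = 0.
Proof. by rewrite /birkhoff_sum big_ord0. Qed.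

Lemma birkhoff_sumS (Z : Type) (R : realType) (f : Z -> Z) (g : Z -> R) n z :
  birkhoff_sum f g n.+1 z = g z + birkhoff_sum f g n (f z).
Proof.
rewrite /birkhoff_sum big_ord_recl/=; congr (_ + _).
by apply: eq_bigr => i _; rewrite -iterSr.
Qed.

Lemma measurable_iter d (Z : measurableType d) (f : Z -> Z) k :
  measurable_fun [set: Z] f -> measurable_fun [set: Z] (iter k f).
Proof.
move=> mf; elim: k => [|k IH]; first exact: measurable_id.
exact: measurableT_comp.
Qed.

Lemma measurable_birkhoff_sum d (Z : measurableType d) (R : realType)
    (f : Z -> Z) (g : Z -> R) n :
  measurable_fun [set: Z] f -> measurable_fun [set: Z] g ->
  measurable_fun [set: Z] (birkhoff_sum f g n).
Proof.
move=> mf mg; apply: measurable_sum => k.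
by apply: measurableT_comp => //; exact: measurable_iter.
Qed.

Section maximal_ergodic.
Context d (Z : measurableType d) (R : realType) (P : {measure set Z -> \bar R}).
Variables (f : Z -> Z) (g : Z -> R).
Hypothesis mf : measurable_fun [set: Z] f.
Hypothesis invf : invariant_measure f P.
Hypothesis intg : P.-integrable [set: Z] (EFin \o g).

Let mg : measurable_fun [set: Z] g.
Proof. exact/measurable_EFinP/(measurable_int _ intg). Qed.

(** This is the maximum of the Birkhoff sums of length at most [n], in the
    recursive form that Garsia's argument uses. *)
Fixpoint max_birkhoff (n : nat) (z : Z) : R :=
  if n is m.+1 then Num.max 0 (g z + max_birkhoff m (f z)) else 0.

Lemma max_birkhoff_ge0 n z : 0 <= max_birkhoff n z.
Proof. by case: n => //= n; rewrite le_max lexx. Qed.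

Lemma birkhoff_sum_le_max n z : birkhoff_sum f g n z <= max_birkhoff n z.
Proof.
elim: n z => [|n IH] z; first by rewrite birkhoff_sum0.
by rewrite birkhoff_sumS /= le_max lerD2l IH orbT.
Qed.

Lemma le_max_birkhoffS n z : max_birkhoff n z <= max_birkhoff n.+1 z.
Proof.
elim: n z => [|n IH] z; first exact: max_birkhoff_ge0.
have := IH (f z) => /= {}IH.
by rewrite ge_max le_max lexx/= le_max; apply/orP; right; rewrite lerD2l.
Qed.

Let integrable_max_birkhoff n : P.-integrable [set: Z] (EFin \o max_birkhoff n).
Proof.
elim: n => [|n IH] /=; first exact: integrable0.
have [intc _] := integral_measure_preserving mf invf IH.
have := integrableD measurableT intg intc.
apply: le_integrable => //.
  apply/measurable_EFinP; apply: measurable_maxr; first exact: measurable_cst.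
  apply: measurable_funD => //.
  exact/measurable_EFinP/(measurable_int _ intc).
by move=> z _ /=; rewrite lee_fin;
  case: (leP 0 (g z + max_birkhoff n (f z))) => _; rewrite ?normr0 ?normr_ge0.
Qed.

Let measurable_max_birkhoff n : measurable_fun [set: Z] (max_birkhoff n).
Proof.
exact/measurable_EFinP/(measurable_int _ (integrable_max_birkhoff n)).
Qed.

Let max_pos n := [set z | 0 < max_birkhoff n z].

Let measurable_max_pos n : measurable (max_pos n).
Proof.
exact: measurable_superlevel.
Qed.

(** On the set where the maximum is positive it is attained by a sum that
    contains the first term [g z]; this is Garsia's inequality. *)
Lemma max_birkhoff_cocycle n z :
  max_birkhoff n z - max_birkhoff n (f z) <= g z * \1_(max_pos n) z.
Proof.
have [zE|zE] := boolP (z \in max_pos n); rewrite indicE; last first.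
  rewrite (negbTE zE) mulr0 subr_le0.
  move: zE; rewrite notin_setE => /negP; rewrite -leNgt => /le_trans; apply.
  exact: max_birkhoff_ge0.
rewrite zE mulr1 lerBlDr; move: zE; rewrite inE /max_pos /=.
case: n => [|n]; first by rewrite /= ltxx.
rewrite [max_birkhoff n.+1 z]/= lt_max ltxx/= => gM.
rewrite ge_max lerD2l le_max_birkhoffS andbT.
by rewrite (le_trans (ltW gM))// lerD2l le_max_birkhoffS.
Qed.

Let integral_max_pos n : (0 <= \int[P]_z (g z * \1_(max_pos n) z)%:E)%E.
Proof.
have [intc eqc] := integral_measure_preserving mf invf
  (integrable_max_birkhoff n).
rewrite (_ : 0%E = \int[P]_z ((max_birkhoff n z)%:E - (max_birkhoff n (f
  z))%:E))%E; last first.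
  rewrite (integralB_EFin measurableT (integrable_max_birkhoff n)
    (intc : P.-integrable _ (EFin \o (max_birkhoff n \o f)))).
  rewrite [X in (_ - X)%E](_ : _ = \int[P]_z (max_birkhoff n z)%:E)%E//.
  by rewrite subee; last exact:
    (integrable_fin_num _ (integrable_max_birkhoff n)).
apply: le_integral => //.
- exact: (integrableB measurableT (integrable_max_birkhoff n) intc).
- apply: le_integrable intg => //.
    by apply/measurable_EFinP; apply: measurable_funM => //;
      exact: measurable_indic.
  move=> z _ /=; rewrite lee_fin normrM indicE.
  by case: (_ \in _); rewrite ?normr1 ?mulr1// normr0 mulr0.
- by move=> z _; rewrite -EFinB lee_fin max_birkhoff_cocycle.
Qed.

(** The right-hand side of Garsia's inequality has integral at least that of the
    coboundary [max_birkhoff n - max_birkhoff n \o f], which is zero. The sets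
    [max_pos n] increase to a set of full measure. *)
Theorem maximal_ergodic :
  {ae P, forall z, exists n, 0 < birkhoff_sum f g n z} ->
  (0 <= \int[P]_z (g z)%:E)%E.
Proof.
move=> gpos.
have [|||||_ _ cvg_int] := @dominated_convergence _ _ _ P setT measurableT
  (fun n z => (g z * \1_(max_pos n) z)%:E) (EFin \o g) (fun z => `|g z|%:E).
- by move=> n; apply/measurable_EFinP; exact: measurable_funM.
- exact/measurable_EFinP.
- apply: filterS gpos => z [m gm] _; apply: cvg_near_cst.
  exists m => // n /= mn; rewrite indicE mem_set ?mulr1// /max_pos /=.
  apply: (lt_le_trans gm); apply: (le_trans (birkhoff_sum_le_max _ _)).
  suff /nondecreasing_seqP : forall k, max_birkhoff k z <= max_birkhoff k.+1 z.
    exact.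
  by move=> k; exact: le_max_birkhoffS.
- exact: integrable_norm.
- apply: aeW => z n _ /=; rewrite lee_fin normrM indicE.
  by case: (_ \in _); rewrite ?normr1 ?mulr1// normr0 mulr0.
- rewrite -(cvg_lim _ cvg_int)//; apply: lime_ge; first by apply/cvg_ex;
  eexists; exact: cvg_int.
  exact: nearW.
Qed.

End maximal_ergodic.

(** * Growth of superadditive processes over ergodic systems *)

Lemma measurable_iter_preimage d (Z : measurableType d) (f : Z -> Z) n A :
  measurable_fun [set: Z] f -> measurable A -> measurable (iter n f @^-1` A).
Proof.
by move=> mf mA; rewrite -[X in measurable X]setTI; exact: measurable_iter.
Qed.

Lemma invariant_measure_iter d (Z : measurableType d) (R : realType)
    (f : Z -> Z) (mu : set Z -> \bar R) n A :
  measurable_fun [set: Z] f -> invariant_measure f mu -> measurable A ->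
  mu (iter n f @^-1` A) = mu A.
Proof.
move=> mf invf; elim: n A => [//|n IH] A mA.
rewrite (_ : iter n.+1 f @^-1` A = f @^-1` (iter n f @^-1` A)).
  by rewrite invf ?IH//; exact: measurable_iter_preimage.
by apply/seteqP; split => z; rewrite /preimage /= -iterS iterSr.
Qed.

(** The points whose whole orbit stays in [F] form a set that is exactly
    invariant, and it has the measure of [F] because the preimages of [F]
    decrease while keeping their measure. *)
Lemma ergodic_subinvariant d (Y : measurableType d) (R : realType)
    (T : Y -> Y) (nu : probability Y R) F :
  measurable_fun [set: Y] T -> invariant_measure T nu -> ergodic T nu ->
  measurable F -> T @^-1` F `<=` F -> nu F = 0%E \/ nu F = 1%E.
Proof.
move=> mT invT ergT mF TF; pose G n := iter n T @^-1` F.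
have mG n : measurable (G n) by exact: measurable_iter_preimage.
have mcap : measurable (\bigcap_n G n) by exact: bigcapT_measurable.
suff -> : nu F = nu (\bigcap_n G n).
  apply: ergT => //; apply/seteqP; split=> [y Gy|y Gy n _].
    case=> [_|n _]; last by rewrite /G /preimage /= -iterS iterSr; exact: Gy.
    by apply: TF; exact: (Gy 0%N).
  by have := Gy n.+1 I; rewrite /G /preimage /= -iterS iterSr.
apply/esym; apply: (@cvg_unique _ _ (nu \o G @ \oo)) => //.
  apply: nonincreasing_cvg_mu => //; first by rewrite ltey_eq fin_num_measure.
  apply/nonincreasing_seqP => n; rewrite subsetEset => y.
  rewrite /G /preimage /=; exact: TF.
rewrite (_ : nu \o G = cst (nu F)); first exact: cvg_cst.
by apply/funext => n; rewrite /= invariant_measure_iter.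
Qed.

(** A process [u] on the factor [Y] that lies below the Birkhoff sums of [g] on
    the extension [Z] grows at most at the rate [\int g]: the set where it grows
    faster than [a] is subinvariant by superadditivity, so if it is not null it
    has full measure, and then almost every point of [Z] has a positive Birkhoff
    sum of [g - a], which the maximal ergodic theorem forbids. *)
Lemma ae_linear_bound d1 d2 (Z : measurableType d1) (Y : measurableType d2)
    (R : realType) (P : probability Z R) (nu : probability Y R)
    (f : Z -> Z) (T : Y -> Y) (p : Z -> Y) (g : Z -> R)
    (u : nat -> Y -> R) (v : Y -> R) (a : R) :
  measurable_fun [set: Z] f -> invariant_measure f P ->
  measurable_fun [set: Y] T -> invariant_measure T nu -> ergodic T nu ->
  measurable_fun [set: Z] p ->
  (forall A, measurable A -> P (p @^-1` A) = nu A) ->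
  P.-integrable [set: Z] (EFin \o g) ->
  (forall n, measurable_fun [set: Y] (u n)) ->
  (forall n y, v y + u n (T y) <= u n.+1 y) ->
  (forall n z, u n (p z) <= birkhoff_sum f g n z) ->
  (\int[P]_z (g z)%:E < a%:E)%E ->
  {ae nu, forall y, exists K, forall n, u n y <= n%:R * a + K}.
Proof.
move=> mf invf mT invT ergT mp pP intg mu superu ug ga.
(* Unboundedness of [u n y - n a] passes from [T y] to [y], since the step costs
   only [v y - a], which does not depend on [n]. *)
pose F := [set y | forall K : nat, exists n, n%:R * a + K%:R < u n y].
have mF : measurable F.
  rewrite (_ : F = \bigcap_K \bigcup_n [set y | n%:R * a + K%:R < u n y]).
    apply: bigcapT_measurable => K; apply: bigcupT_measurable => n.
    exact: measurable_superlevel.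
  apply/seteqP; split => y Fy K.
    by move=> _; have [n ?] := Fy K; exists n.
  by have [n _ ?] := Fy K I; exists n.
have TF : T @^-1` F `<=` F.
  move=> y Fy K; have [n un] := Fy (Num.bound `|K%:R + a - v y|).
  exists n.+1; apply: lt_le_trans (superu n y).
  have := archi_boundP (normr_ge0 (K%:R + a - v y)).
  have := ler_norm (K%:R + a - v y).
  rewrite -natr1; lra.
have [F0|F1] := ergodic_subinvariant mT invT ergT mF TF.
  exists F; split => // y /= /forallNP bad K.
  have /existsNP[n /negP] := bad K%:R; rewrite -ltNge => ?.
  by exists n.
exfalso; suff : (0 <= \int[P]_z (g z - a)%:E)%E.
  apply/negP; rewrite -ltNge.
  rewrite (integralB_EFin measurableT intg (finite_measure_integrable_cst P a
    measurableT))//.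
  rewrite [X in (_ - X)%E](_ : _ = a%:E).
    by rewrite lteBlDr// add0e.
  by have := @integral_cst _ _ _ P [set: Z] measurableT a%:E;
    rewrite /= probability_setT mule1.
apply: (maximal_ergodic mf invf).
  exact: (integrableB measurableT intg (finite_measure_integrable_cst P a
    measurableT)).
exists (p @^-1` (~` F)); split.
- by rewrite -[X in measurable X]setTI; apply: mp => //; exact: measurableC.
- by rewrite /= pP; [rewrite probability_setC// F1 subee|exact: measurableC].
- move=> z /= + /(_ 0%N) [n un]; apply; exists n.
  have -> : birkhoff_sum f (fun z => g z - a) n z =
      birkhoff_sum f g n z - n%:R * a.
    rewrite /birkhoff_sum big_split/= -[in RHS](card_ord n) sumr_const.
    by rewrite mulNrn mulr_natl card_ord.
  by rewrite subr_gt0; apply: lt_le_trans (ug n z); move: un; rewrite addr0.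
Qed.

Lemma limsup_of_linear_bounds (R : realType) (u : nat -> R) (c : R) :
  (forall k : nat, exists K, forall n, u n <= n%:R * (c + k.+1%:R^-1) + K) ->
  forall e, 0 < e -> \forall n \near \oo, n%:R^-1 * u n <= c + e.
Proof.
move=> uK e e0; have e20 : 0 < e / 2 by rewrite divr_gt0.
have [k _ /(_ k (leqnn k)) ke] := near_infty_natSinv_lt (PosNum e20).
have [K uk] := uK k.
have [m _ mK] := nbhs_infty_ger (K / (e / 2)).
exists m.+1 => // -[//|n] /= mn.
have n0 : 0 < n.+1%:R :> R by rewrite ltr0n.
rewrite mulrC ler_pdivrMr//; apply: le_trans (uk _) _.
have := mK n.+1 (ltnW mn); rewrite /= ler_pdivrMr//.
have : n.+1%:R * k.+1%:R^-1 <= n.+1%:R * (e / 2) by rewrite ler_pM2l// ltW.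
move: (n.+1%:R) (k.+1%:R^-1) {n0 mn ke} => N r; lra.
Qed.

(** The pointwise ergodic theorem, obtained by applying the one-sided growth
    bound to [g] and to [- g]. *)
Lemma ergodic_theorem d (Y : measurableType d) (R : realType)
    (nu : probability Y R) (T : Y -> Y) (g : Y -> R) :
  measurable_fun [set: Y] T -> invariant_measure T nu -> ergodic T nu ->
  nu.-integrable [set: Y] (EFin \o g) ->
  {ae nu, forall y,
    n%:R^-1 * birkhoff_sum T g n y @[n --> \oo] --> fine (\int[nu]_y (g y)%:E)}.
Proof.
move=> mT invT ergT.
have bound (h : Y -> R) : nu.-integrable [set: Y] (EFin \o h) ->
    {ae nu, forall y, forall e, 0 < e -> \forall n \near \oo,
      n%:R^-1 * birkhoff_sum T h n y <= fine (\int[nu]_y (h y)%:E) + e}.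
  move=> inth.
  have fin : (\int[nu]_y (h y)%:E)%E \is a fin_num.
    exact: (integrable_fin_num _ inth).
  have : {ae nu, forall y, forall k : nat, exists K, forall n,
      birkhoff_sum T h n y <=
      n%:R * (fine (\int[nu]_y (h y)%:E) + k.+1%:R^-1) + K}.
    apply: ae_foralln => k.
    apply: (@ae_linear_bound _ _ _ _ _ nu nu T T id h _ h) => //.
    - move=> n; apply: measurable_birkhoff_sum => //.
      exact/measurable_EFinP/(measurable_int _ inth).
    - by move=> n y; rewrite birkhoff_sumS.
    - by rewrite EFinD fineK// lteDl// lte_fin invr_gt0.
  by apply: filterS => y; exact: limsup_of_linear_bounds.
move=> intg; have intNg : nu.-integrable [set: Y] (EFin \o (fun y => - g y)).
  by have := integrableN intg.
apply: filterS2 (bound _ intg) (bound _ intNg) => y up dn.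
have intN : fine (\int[nu]_y (- g y)%:E) = - fine (\int[nu]_y (g y)%:E).
  rewrite -fineN -integralN//.
  by apply: integrable_add_def.
have sumN n : birkhoff_sum T (fun y => - g y) n y = - birkhoff_sum T g n y.
  by rewrite /birkhoff_sum sumrN.
apply/cvgrPdist_le => e e0; near=> n.
have upn : n%:R^-1 * birkhoff_sum T g n y <= fine (\int[nu]_y (g y)%:E) + e.
  by near: n; exact: up.
have : n%:R^-1 * birkhoff_sum T (fun y => - g y) n y <=
    fine (\int[nu]_y (- g y)%:E) + e by near: n; exact: dn.
rewrite sumN intN mulrN => dnn.
by rewrite ler_distlC; apply/andP; split => //; lra.
Unshelve. all: end_near. Qed.

(** * Finitely additive means on the Cantor space *)

(** Frequencies of visits have limits along an ultrafilter for every subset at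
    once; what survives of a probability in the limit is this. *)
Record mean (Z : Type) (R : realType) (M : set Z -> R) : Prop := Mean {
  mean_ge0 : forall A, 0 <= M A;
  mean_setT : M [set: Z] = 1;
  mean_setU : forall A B, A `&` B = set0 -> M (A `|` B) = M A + M B }.

Section mean_theory.
Context (Z : Type) (R : realType) (M : set Z -> R).
Hypothesis meanM : mean M.

Lemma mean_set0 : M set0 = 0.
Proof.
by have := mean_setU meanM (set0I set0); rewrite setU0; lra.
Qed.

Lemma mean_setC A : M (~` A) = 1 - M A.
Proof.
rewrite -(mean_setT meanM) -(setvU A) (mean_setU meanM) ?setICl//.
by rewrite addrK.
Qed.

Lemma le_mean A B : A `<=` B -> M A <= M B.
Proof.
move=> AB; rewrite -(setDUK AB) (mean_setU meanM) ?lerDl ?(mean_ge0 meanM)//.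
by rewrite setDIK.
Qed.

Lemma mean_setU_le A B : M (A `|` B) <= M A + M B.
Proof.
rewrite -[A `|` B](setDUK (@subsetUl _ A B)) (mean_setU meanM) ?setDIK//.
by rewrite lerD2l; apply: le_mean => z [[]].
Qed.

Lemma mean_bigsetU_le (F : nat -> set Z) n :
  M (\big[setU/set0]_(k < n) F k) <= \sum_(k < n) M (F k).
Proof.
elim: n => [|n IH]; first by rewrite !big_ord0 mean_set0.
rewrite !big_ord_recr/=; apply: le_trans (mean_setU_le _ _) _.
by rewrite lerD2r.
Qed.

End mean_theory.

Lemma mean_preimage (Z W : Type) (R : realType) (M : set Z -> R) (f : Z -> W) :
  mean M -> mean (fun A => M (f @^-1` A)).
Proof.
move=> meanM; split=> [A||A B AB]; first exact: mean_ge0.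
  by rewrite preimage_setT mean_setT.
by rewrite preimage_setU mean_setU// -preimage_setI AB preimage_set0.
Qed.

Definition agree (n : nat) (z w : cantor_space) : Prop :=
  forall i, (i < n)%N -> z i = w i.

Lemma agreeW m n z w : (m <= n)%N -> agree n z w -> agree m z w.
Proof. by move=> mn zw i im; apply: zw; exact: leq_trans mn. Qed.

Lemma agree_sym n z w : agree n z w -> agree n w z.
Proof. by move=> zw i iN; rewrite zw. Qed.

Lemma cvg_agree (z : cantor_space) (w : nat -> cantor_space) :
  (forall n, agree n z (w n)) -> w @ \oo --> z.
Proof.
move=> zw; apply/(@pointwise_cvgP nat bool) => i.
apply: cvg_near_cst; exists i.+1 => // n /= iN.
by rewrite -(zw n i iN).
Qed.

(** If no prefix neighbourhood of [z] lay in [V], then points outside [V] that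
    share longer and longer prefixes with [z] would converge to [z]. *)
Lemma nbhs_agree (z : cantor_space) (V : set cantor_space) :
  nbhs z V <-> exists n, agree n z `<=` V.
Proof.
split=> [Vz|[n /filterS]]; last first.
  apply; elim: n => [|n IH]; first by apply: filterS filterT => w _ i.
  have zn := @proj_continuous _ (fun=> bool) n z _ (discrete_set1 (z n)).
  apply: filterS2 IH zn => w zw wn i; rewrite ltnS leq_eqVlt => /orP[/eqP->//|].
  exact: zw.
apply: contrapT => /forallNP noV.
have /choice[w zw] n : exists w, agree n z w /\ ~ V w.
  by have /existsNP[w /not_implyP] := noV n; exists w.
have [N _ /(_ N (leqnn N))] := cvg_agree (fun n => (zw n).1) Vz.
exact: (zw N).2.
Qed.

(** This is compactness of the Cantor space: a set given by finitely many bits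
    is closed. *)
Lemma nonincreasing_prefix_sets (K : nat -> set cantor_space) :
  (forall n, exists N, forall z w, agree N z w -> K n z -> K n w) ->
  (forall m n, (m <= n)%N -> K n `<=` K m) ->
  (forall n, K n !=set0) -> exists z, forall n, K n z.
Proof.
move=> preK decK K0; pose F : set_system cantor_space := filter_from [set:
  nat] K.
have PF : ProperFilter F.
  apply: filter_from_proper => [|n _]; last exact: K0.
  apply: filter_from_filter; first by exists 0%N.
  move=> m n _ _; exists (maxn m n) => // z Kz; split.
    exact: decK (leq_maxl m n) _ Kz.
  exact: decK (leq_maxr m n) _ Kz.
have [z [_ clz]] := cantor_space_compact PF filterT.
exists z => n; have [N KN] := preK n.
have [w [Kw zw]] : K n `&` agree N z !=set0.
  by apply: clz; [exists n|apply/nbhs_agree; exists N].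
exact: KN (agree_sym zw) Kw.
Qed.

(** An alias of the product, to be equipped with the algebra of sets that are
    cut out by finitely many bits in the first coordinate. *)
Definition cylinder_space d (Y : algebraOfSetsType d) : Type :=
  (cantor_space * Y)%type.

HB.instance Definition _ d (Y : algebraOfSetsType d) :=
  Pointed.on (cylinder_space Y).

Definition cylinder d (Y : algebraOfSetsType d) :
  set (set (cylinder_space Y)) :=
  [set E | (exists N, forall z w y, agree N z w -> E (z, y) -> E (w, y)) /\
           forall z, measurable [set y | E (z, y)]].

Section cylinder_algebra.
Context d (Y : algebraOfSetsType d).

Let cylinder0 : cylinder (set0 : set (cylinder_space Y)).
Proof. by split => [|z]; [exists 0%N|exact: measurable0]. Qed.

Let cylinderU : setU_closed (@cylinder d Y).
Proof.
move=> E F [[N EN] mE] [[M FM] mF]; split; last first.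
  by move=> z; exact: (measurableU _ _ (mE z) (mF z)).
exists (maxn N M) => z w y zw [Ezy|Fzy]; [left|right].
  exact: EN (agreeW (leq_maxl _ _) zw) Ezy.
exact: FM (agreeW (leq_maxr _ _) zw) Fzy.
Qed.

Let cylinderC : setC_closed (@cylinder d Y).
Proof.
move=> E [[N EN] mE]; split; last first.
  by move=> z; exact: (measurableC (mE z)).
by exists N => z w y zw Ezy Ewy; apply: Ezy; exact: EN (agree_sym zw) Ewy.
Qed.

HB.instance Definition _ := isAlgebraOfSets.Build d (cylinder_space Y)
  cylinder0 cylinderU cylinderC.

(** Only the finitely many prefixes of length [N] matter, so the projection is a
    finite union of sections. *)
Lemma measurable_cylinder_proj (E : set (cylinder_space Y)) :
  measurable E -> measurable [set y | exists z, E (z, y)].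
Proof.
move=> [[N EN] mE].
pose ext (w : N.-tuple bool) : cantor_space := fun i => nth false w i.
rewrite (_ : [set y | _] =
    \bigcup_(w in [set: N.-tuple bool]) [set y | E (ext w, y)]).
  by apply: fin_bigcup_measurable => //; exact: finite_finset.
apply/seteqP; split=> y /= [z]; last by move=> _ Ezy; exists (ext z).
move=> Ezy; exists [tuple of mkseq z N] => //; apply: EN Ezy => i iN.
by rewrite /ext /= nth_mkseq.
Qed.

Section extension.
Context (R : realType) (nu : {measure set Y -> \bar R})
  (M : set (cantor_space * Y) -> R).
Hypothesis meanM : mean M.
Hypothesis M_marginal : forall B : set Y, measurable B ->
  (M [set w | B w.2])%:E = nu B.

Definition cylinder_mean (E : set (cylinder_space Y)) : \bar R := (M E)%:E.

Let cylinder_mean_ge0 E : (0 <= cylinder_mean E)%E.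
Proof. by rewrite lee_fin (mean_ge0 meanM). Qed.

Let cylinder_mean_additive : measure_function.semi_additive cylinder_mean.
Proof.
apply/(additive2P _).2 => [|A B _ _ AB].
  by rewrite /cylinder_mean (mean_set0 meanM).
by rewrite /cylinder_mean (mean_setU meanM AB).
Qed.

HB.instance Definition _ := isContent.Build d (cylinder_space Y) R
  cylinder_mean cylinder_mean_ge0 cylinder_mean_additive.

(** Countable additivity comes from compactness in the first coordinate and the
    countable additivity of [nu] in the second: if cylinders decrease to the
    empty set, then so do their projections to [Y]. *)
Let cylinder_mean_sigma_subadditive :
  measurable_subset_sigma_subadditive cylinder_mean.
Proof.
move=> A F mF mA AF.
pose D n := A `\` \big[setU/set0]_(k < n) F k.
have mD n : measurable (D n).
  by apply: measurableD => //; exact: bigsetU_measurable.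
have decD m n : (m <= n)%N -> D n `<=` D m.
  by move=> mn; apply: setDS; exact: subset_bigsetU.
pose Q n := [set y | exists z, D n (z, y)].
have mQ n : measurable (Q n) by exact: measurable_cylinder_proj.
have capQ : \bigcap_n Q n = set0.
  apply/seteqP; split=> // y Qy.
  have [|m n mn z|n|z Dz] := @nonincreasing_prefix_sets (fun n =>
    [set z | D n (z, y)]).
  - by move=> n; have [[N DN] _] := mD n; exists N => z w zw; exact: DN.
  - exact: decD.
  - exact: Qy.
  have [Az _] := Dz 0%N; have [n _ Fn] := AF _ Az.
  have [_] := Dz n.+1; apply; rewrite big_ord_recr/=; by right.
have Q0 : nu (Q n) @[n --> \oo] --> 0%E.
  rewrite -(measure0 nu) -capQ; apply: nonincreasing_cvg_mu => //.
  - by rewrite -M_marginal// ltry.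
  - by rewrite capQ.
  - move=> m n mn; rewrite subsetEset => y [z Dz]; exists z; exact: decD Dz.
have le_n n : (cylinder_mean A <= \sum_(k <oo) cylinder_mean (F k) + nu (Q
  n))%E.
  have le1 : (cylinder_mean A <= \sum_(k < n) cylinder_mean (F k) + nu (Q n))%E.
    rewrite -M_marginal// sumEFin -EFinD lee_fin.
    apply: (@le_trans _ _ (M ((\big[setU/set0]_(k < n) F k) `|` D n))).
      apply: (le_mean meanM) => w Aw.
      by have [?|?] := pselect ((\big[setU/set0]_(k < n) F k) w); [left|right].
    apply: (le_trans (mean_setU_le meanM _ _)); apply: lerD.
      exact: (mean_bigsetU_le meanM).
    by apply: (le_mean meanM) => -[z y] Dzy; exists z.
  apply: (le_trans le1); rewrite leeD2r//.
  rewrite -(big_mkord xpredT (cylinder_mean \o F)).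
  exact: nneseries_lim_ge.
have : (fun n => \sum_(k <oo) cylinder_mean (F k) + nu (Q n))%E @ \oo -->
    (\sum_(k <oo) cylinder_mean (F k) + 0)%E.
  apply: cvgeD => //; last exact: cvg_cst.
  by rewrite fin_num_adde_defl.
rewrite adde0 => lim_n; apply: (cvge_to_ge lim_n).
by apply: nearW => n; exact: le_n.
Qed.

HB.instance Definition _ := Content_SigmaSubAdditive_isMeasure.Build d R
  (cylinder_space Y) cylinder_mean cylinder_mean_sigma_subadditive.

(** On the cylinders a mean with countably additive marginal is therefore a
    measure, and Caratheodory's theorem extends it. *)
Lemma mean_extension :
  exists lam : probability
      (g_sigma_algebraType (@measurable d (cylinder_space Y))) R,
    forall E : set (cylinder_space Y), measurable E -> lam E = (M E)%:E.
Proof.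
have mE (E : set (cylinder_space Y)) : measurable E ->
    measure_extension cylinder_mean E = (M E)%:E.
  by move=> cE; exact: measurable_mu_extE.
have mT : measure_extension cylinder_mean setT = 1%E.
  by rewrite mE ?(mean_setT meanM)//;
    exact: (@measurableT _ (cylinder_space Y)).
pose mP := Measure_isProbability.Build _ _ _ (measure_extension cylinder_mean)
  mT.
pose lam : probability _ R := HB.pack (measure_extension cylinder_mean) mP.
by exists lam.
Qed.

End extension.
End cylinder_algebra.

(** * Borel measures below a mean *)

Definition is_base (Y : topologicalType) (b : nat -> set Y) : Prop :=
  (forall i, open (b i)) /\
  forall y (V : set Y), nbhs y V -> exists2 i, b i y & b i `<=` V.

(** The largest open set whose product with [b i] lies in [O]. *)
Definition tube (X Y : topologicalType) (b : nat -> set Y) (O : set (X * Y))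
  (i : nat) : set X := interior [set x | forall y, b i y -> O (x, y)].

Lemma open_bigcup_rectangles (X Y : topologicalType) (b : nat -> set Y)
    (O : set (X * Y)) :
  is_base b -> open O -> O = \bigcup_i (tube b O i `*` b i).
Proof.
move=> [bo bbase] oO; apply/seteqP; split=> [[x y] Oxy|[x y] [i _ [/= Vx bi]]].
  have [[U V] /= [Ux Vy] UV] : nbhs (x, y) O by exact: open_nbhs_nbhs.
  have [i biy biV] := bbase _ _ Vy; exists i => //; split => //=.
  apply: filterS Ux => x' Ux' y' biy'; apply: (UV (x', y')); split => //=.
  exact: biV.
exact: interior_subset Vx _ bi.
Qed.

Definition open_rectangles (X : topologicalType) d (Y : algebraOfSetsType d) :
    set (set (X * Y)) :=
  [set C | exists V B, [/\ open V, measurable B & C = V `*` B]].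

Section measure_of_mean.
Context (R : realType) (X : pmetricType R) d (Y : algebraOfSetsType d).
Hypothesis compactX : compact [set: X].
Variables (nu : {measure set Y -> \bar R}) (M : set (X * Y) -> R).
Hypothesis meanM : mean M.
Hypothesis M_marginal : forall B : set Y, measurable B ->
  (M [set w | B w.2])%:E = nu B.

Section cylinder_rectangles.
Variable pi : cantor_space -> X.

(** The cylinders that exhaust the preimage of [V `*` B] from inside when [V] is
    open. *)
Definition cylinder_rectangle (V : set X) (B : set Y) (n : nat) :
    set (cylinder_space Y) :=
  [set w | agree n w.1 `<=` pi @^-1` V /\ B w.2].

Lemma measurable_cylinder_rectangle V B n :
  measurable B -> measurable (cylinder_rectangle V B n).
Proof.
move=> mB; split=> [|z].
  exists n => z w y zw [zV By]; split => // w' ww'; apply: zV => i iN.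
  exact: etrans (zw i iN) (ww' i iN).
have [zV|zV] := pselect (agree n z `<=` pi @^-1` V).
  rewrite (_ : [set y | _] = B)//; apply/seteqP; split => y //=.
  by case.
by rewrite (_ : [set y | _] = set0)//; apply/seteqP; split => y //= [].
Qed.

Lemma bigcup_cylinder_rectangle V B : continuous pi -> open V ->
  [set w | V (pi w.1) /\ B w.2] = \bigcup_n cylinder_rectangle V B n.
Proof.
move=> cpi oV; apply/seteqP; split=> [[z y] /= [Vz By]|[z y] [n _ [zV By]]].
  have /nbhs_agree[n zV] : nbhs z (pi @^-1` V) by exact/cpi/open_nbhs_nbhs.
  by exists n.
by split => //; apply: zV => i.
Qed.

End cylinder_rectangles.

(** A compact metric space is a continuous image of the Cantor space. A section
    of the surjection carries the mean to the Cantor space, where it becomes a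
    measure on the cylinders, and the surjection carries the extended measure
    back. Mass may only move to the boundary in the process: the preimage of an
    open set is exhausted by cylinders, and these have their mean as measure. *)
Lemma measure_of_mean :
  exists lam : probability (g_sigma_algebraType (@open_rectangles X d Y)) R,
  forall (V : nat -> set X) (B : nat -> set Y),
    (forall i, open (V i)) -> (forall i, measurable (B i)) ->
    (lam (\bigcup_i (V i `*` B i)) <= (M (\bigcup_i (V i `*` B i)))%:E)%E.
Proof.
have [pi cpi] := @cantor_surj R X compactX (@metric_hausdorff R X).
have [sigma piK] : exists sigma : X -> cantor_space, cancel sigma pi.
  have /choice[sigma piK] x : exists z, pi z = x.
    by have [z _ <-] := @surj _ _ _ _ pi x I; exists z.
  by exists sigma.
pose f (p : X * Y) := (sigma p.1, p.2).
pose phi (w : cantor_space * Y) : X * Y := (pi w.1, w.2).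
have [m mE] := mean_extension (mean_preimage f meanM) M_marginal.
pose C V B n := cylinder_rectangle pi V B n.
have mC V B n : measurable B -> measurable (C V B n).
  exact: measurable_cylinder_rectangle.
have preC V B : open V -> phi @^-1` (V `*` B) = \bigcup_n C V B n.
  by move=> oV; rewrite -(bigcup_cylinder_rectangle B cpi oV).
pose psi : g_sigma_algebraType (@measurable _ (cylinder_space Y)) ->
  g_sigma_algebraType (@open_rectangles X d Y) := phi.
have mpsi : measurable_fun setT psi.
  apply: (@measurability _ _ _ _ setT psi (@open_rectangles X d Y)) => //.
  move=> _ [_ [V [B [oV mB ->]]] <-].
  rewrite setTI [psi @^-1` _]preC//; apply: bigcupT_measurable => n.
  by apply: sub_sigma_algebra; exact: mC.
pose mfun_psi : {mfun _ >-> _} :=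
  HB.pack psi (isMeasurableFun.Build _ _ _ _ _ mpsi).
exists (distribution m mfun_psi) => V B oV mB.
pose E n := \bigcup_(i in `I_n) C (V i) (B i) n.
have mEn n : measurable (E n : set (cylinder_space Y)).
  by apply: fin_bigcup_measurable => // i _; exact: mC.
have ndE : nondecreasing_seq E.
  move=> p q pq; rewrite subsetEset => w [i /= ip [pV Bw]].
  exists i; first exact: leq_trans pq.
  by split => // z wz; apply: pV; exact: agreeW wz.
have CP i w : (V i `*` B i) (psi w) <-> exists n, C (V i) (B i) n w.
  have -> : (V i `*` B i) (psi w) = (phi @^-1` (V i `*` B i)) w by [].
  by rewrite preC//; split=> [[n _]|[n]]; exists n.
have preG : psi @^-1` (\bigcup_i (V i `*` B i)) = \bigcup_n E n.
  rewrite preimage_bigcup; apply/seteqP; split=> [w [i _]|w [n _ [i _ Cw]]].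
    move=> /CP[n [nV Bw]]; exists (maxn n i.+1) => //.
    exists i; first by rewrite /= leq_max ltnSn orbT.
    by split => // z wz; apply: nV; apply: agreeW wz; exact: leq_maxl.
  by exists i => //; apply/CP; exists n.
suff : (m (\bigcup_n E n) <= (M (\bigcup_i (V i `*` B i)))%:E)%E.
  by rewrite -preG.
have cvgE : m \o E @ \oo --> m (\bigcup_n E n).
  apply: nondecreasing_cvg_mu => //.
    by move=> n; apply: sub_sigma_algebra; exact: mEn.
  apply: bigcupT_measurable => n; apply: sub_sigma_algebra; exact: mEn.
apply: (cvge_to_le cvgE); apply: nearW => n; rewrite /= mE// lee_fin.
apply: (le_mean meanM) => -[x y] fE.
have : (psi @^-1` (\bigcup_i (V i `*` B i))) (f (x, y)) by rewrite preG;
  exists n.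
by rewrite /psi /phi /f /preimage /= piK.
Qed.

End measure_of_mean.

(** * Joinings below an invariant mean *)

(** A measure below a mean on open sets is above it on closed sets; sandwiching
    closed sets between open ones makes both bounds available. *)
Lemma open_inner_approximation (R : realType) (X : pseudoMetricType R)
    (V : set X) : open V ->
  exists U K : nat -> set X,
    [/\ (forall j, open (U j)), (forall j, closed (K j)),
    (forall j, U j `<=` K j /\ K j `<=` V),
    nondecreasing_seq U & \bigcup_j U j = V].
Proof.
move=> oV; pose A j := [set x | ball x (j.+1%:R^-1 : R) `<=` V].
have pos j : 0 < j.+1%:R^-1 :> R by rewrite invr_gt0.
exists (fun j => interior (A j)), (fun j => closure (A j)); split.
- by move=> j; exact: open_interior.
- by move=> j; exact: closed_closure.
- split=> [x /interior_subset /subset_closure//|x].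
  move=> /(_ _ (nbhsx_ballx x _ (pos j)))[w [Aw xw]].
  by apply: Aw; exact: ball_sym.
- move=> i j ij; rewrite subsetEset; apply: interiorS => x Ax.
  apply: subset_trans Ax; apply: le_ball.
  by rewrite lef_pV2 ?posrE ?ltr0n// ler_nat.
apply/seteqP; split=> [x [j _ /interior_subset]|x Vx].
  by apply; exact: ballxx.
have [e /= e0 xV] : nbhs_ball x V by rewrite nbhs_ballE; exact: open_nbhs_nbhs.
have e20 : 0 < e / 2 by rewrite divr_gt0.
have [j _ /(_ j (leqnn j)) je] := near_infty_natSinv_lt (PosNum e20).
exists j => //; apply/nbhs_ballP; exists (e / 2) => //= w xw z wz.
apply: xV; rewrite /ball_ (splitr e); apply: ball_triangle xw _.
by apply: le_ball wz; exact: ltW.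
Qed.

Lemma measurable_snd_borel (X Y : ptopologicalType) :
  measurable_fun setT (snd : borel (X * Y)%type -> borel Y).
Proof.
apply: (@measurability _ _ (borel (X * Y)%type) (borel Y) setT snd (@open Y))
  => //.
move=> _ [W oW <-]; rewrite setTI; apply: sub_sigma_algebra.
by apply: open_comp oW => z _; exact: cvg_snd.
Qed.

Lemma measurable_open_rectangle (X Y : ptopologicalType) (V : set X) (B :
  set Y) :
  open V -> measurable (B : set (borel Y)) ->
  measurable (V `*` B : set (borel (X * Y)%type)).
Proof.
move=> oV mB; rewrite (_ : V `*` B = (fst @^-1` V) `&` (snd @^-1` B))//.
apply: measurableI.
  apply: sub_sigma_algebra; apply: open_comp oV => z _; exact: cvg_fst.
by have := @measurable_snd_borel X Y measurableT _ mB; rewrite setTI.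
Qed.

Lemma measurable_prod_map (X Y : ptopologicalType) (b : nat -> set Y)
    (S : X -> X) (T : Y -> Y) :
  is_base b -> continuous S ->
  measurable_fun setT (T : borel Y -> borel Y) ->
  measurable_fun setT (prod_map S T : borel (X * Y)%type -> borel (X * Y)%type).
Proof.
move=> baseb contS measT.
apply: (@measurability _ _ (borel (X * Y)%type) (borel (X * Y)%type) setT
  (prod_map S T) open) => //.
move=> _ [W oW <-]; rewrite setTI (open_bigcup_rectangles baseb oW).
rewrite preimage_bigcup; apply: bigcupT_measurable => i.
rewrite (_ : _ @^-1` _ = (S @^-1` tube b W i) `*` (T @^-1` b i))//.
apply: measurable_open_rectangle.
  by apply: open_comp (@open_interior _ _) => x _; exact: contS.
have mb : measurable (b i : set (borel Y)).
  by apply: sub_sigma_algebra; exact: baseb.1.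
by have := measT measurableT _ mb; rewrite setTI.
Qed.

Section borel_measure_of_mean.
Context (R : realType) (X : pmetricType R) (Y : ptopologicalType).
Variables (B0 : set (set Y)) (b : nat -> set Y).
Hypothesis compactX : compact [set: X].
Hypotheses (B00 : B0 set0) (B0U : setU_closed B0) (B0C : setC_closed B0).
Hypothesis B0_borel : forall B, B0 B -> measurable (B : set (borel Y)).
Hypotheses (baseb : is_base b) (B0b : forall i, B0 (b i)).
Variables (nu : probability (borel Y) R) (M : set (X * Y) -> R).
Hypothesis meanM : mean M.
Hypothesis M_marginal : forall B, B0 B -> (M [set w | B w.2])%:E = nu B.

Lemma borel_generated : measurable = <<s B0>> :> set (set (borel Y)).
Proof.
apply/seteqP; split; last by apply: smallest_sub => //;
  exact: sigma_algebra_measurable.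
apply: smallest_sub; first exact: smallest_sigma_algebra.
move=> W oW; rewrite (_ : W = \bigcup_(i in [set i | b i `<=` W]) b i).
  rewrite bigcup_mkcond; apply: sigma_algebra_bigcup => i.
  case: ifPn => _; first by apply: sub_sigma_algebra; exact: B0b.
  by apply: sub_sigma_algebra.
apply/seteqP; split=> [y Wy|y [i /= + ?]]; last exact.
have [i biy biW] := baseb.2 y W (open_nbhs_nbhs (conj oW Wy)).
by exists i.
Qed.

(** The measure of [measure_of_mean] lives on the sigma-algebra of rectangles
    with second factor in [B0]; since [B0] contains a countable base, this
    contains the Borel sets of the product topology. *)
Lemma borel_measure_of_mean :
  exists lam : probability (borel (X * Y)%type) R,
  forall (V : nat -> set X) (B : nat -> set Y),
    (forall i, open (V i)) -> (forall i, B0 (B i)) ->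
    (lam (\bigcup_i (V i `*` B i)) <= (M (\bigcup_i (V i `*` B i)))%:E)%E.
Proof.
pose Y0 : algebraOfSetsType default_measure_display :=
  HB.pack (Y : Type) (Pointed.on Y)
    (isAlgebraOfSets.Build default_measure_display Y B00 B0U B0C).
pose nu0 : set Y0 -> \bar R := nu.
have nu0_sigma_additive : semi_sigma_additive nu0.
  move=> F mF tF mUF; apply: (@measure_semi_sigma_additive _ _ _ nu) => //.
    by move=> i; exact: B0_borel (mF i).
  exact: B0_borel mUF.
pose nu0_measure : {measure set Y0 -> \bar R} :=
  HB.pack nu0 (isMeasure.Build _ Y0 R nu0 (measure0 nu) (measure_ge0 nu)
    nu0_sigma_additive).
have [m mM] := measure_of_mean compactX (nu := nu0_measure) meanM M_marginal.
pose inclusion : g_sigma_algebraType (@open_rectangles X _ Y0) ->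
  borel (X * Y)%type := id.
have mincl : measurable_fun setT inclusion.
  apply: (@measurability _ _ _ _ setT inclusion open) => //.
  move=> _ [W oW <-]; rewrite setTI (open_bigcup_rectangles baseb oW).
  apply: bigcupT_measurable => i; apply: sub_sigma_algebra.
  exists (tube b W i), (b i); split => //; exact: open_interior.
pose mfun_incl : {mfun _ >-> _} :=
  HB.pack inclusion (isMeasurableFun.Build _ _ _ _ _ mincl).
by exists (distribution m mfun_incl) => V B oV mB; exact: mM.
Qed.

Section joining.
Variables (S : X -> X) (T : Y -> Y).
Hypotheses (contS : continuous S)
  (measT : measurable_fun setT (T : borel Y -> borel Y)).
Hypothesis B0T : forall B, B0 B -> B0 (T @^-1` B).
Hypothesis M_invariant : forall E, M (prod_map S T @^-1` E) = M E.

Variable lam : probability (borel (X * Y)%type) R.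
Hypothesis lamM : forall (V : nat -> set X) (B : nat -> set Y),
  (forall i, open (V i)) -> (forall i, B0 (B i)) ->
  (lam (\bigcup_i (V i `*` B i)) <= (M (\bigcup_i (V i `*` B i)))%:E)%E.

Lemma open_rectangle_le_mean V B : open V -> B0 B ->
  (lam (V `*` B) <= (M (V `*` B))%:E)%E.
Proof.
move=> oV mB; have := lamM (fun=> oV) (fun=> mB).
by rewrite bigcup_const//; exists 0%N.
Qed.

Let B0_setT : B0 setT. Proof. by rewrite -setC0; exact: B0C. Qed.

(** Complements turn the upper bound on open sets into a lower bound on closed
    ones, because both [lam] and [M] have total mass one. *)
Lemma mean_le_closed_rectangle K B : closed K -> B0 B ->
  ((M (K `*` B))%:E <= lam (K `*` B))%E.
Proof.
move=> cK mB; have oK : open (~` K) by exact: closed_openC.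
pose V i := if i is 0%N then ~` K else setT.
pose C i := if i is 0%N then setT else ~` B.
have oV i : open (V i) by case: i => //= _; exact: openT.
have mC i : B0 (C i) by case: i => //= _; exact: B0C.
have CE : ~` (K `*` B) = \bigcup_i (V i `*` C i).
  apply/seteqP; split=> [[x y] /= /not_andP[Kx|By]|[x y] [[|i] _ /= [Vx Cy]] []
    //].
    by exists 0%N.
  by exists 1%N.
have mKB : measurable (~` (K `*` B) : set (borel (X * Y)%type)).
  rewrite CE; apply: bigcupT_measurable => i;
    apply: measurable_open_rectangle => //.
  exact: B0_borel.
have := lamM oV mC; rewrite -CE (mean_setC meanM) => lamC.
have : lam (K `*` B) = (1 - lam (~` (K `*` B)))%E.
  by rewrite -probability_setC// setCK.
move=> ->; rewrite leeBrDr ?fin_num_measure//.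
by apply: (le_trans (leeD2l _ lamC)); rewrite -EFinD lee_fin subrKC.
Qed.

Let setT_rect (B : set Y) : [set z | B z.2] = [set: X] `*` B.
Proof. by apply/seteqP; split=> [z|z []]. Qed.

Lemma marginal_of_mean (B : set (borel Y)) : measurable B ->
  lam [set z | B z.2] = nu B.
Proof.
move=> mB; pose q : borel (X * Y)%type -> borel Y := snd.
pose mfun_q : {mfun _ >-> _} :=
  HB.pack q (isMeasurableFun.Build _ _ _ _ _ (@measurable_snd_borel X Y)).
apply: (@measure_unique _ R (borel Y) B0 (fun=> setT) borel_generated _ _ _
  (distribution lam mfun_q) nu) => //.
- move=> A C mA mC; rewrite -[A `&` C]setCK setCI.
  by apply: B0C; apply: B0U; exact: B0C.
- by rewrite bigcup_const//; exists 0%N.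
- move=> A mA; transitivity (lam ([set: X] `*` A)).
    by rewrite -setT_rect.
  transitivity (M ([set: X] `*` A))%:E.
    apply/eqP; rewrite eq_le mean_le_closed_rectangle//.
    by rewrite open_rectangle_le_mean//; exact: openT.
  by rewrite -setT_rect; exact: M_marginal.
- by move=> _; rewrite /= probability_setT ltry.
Qed.

Let measurable_B0_rectangle V B : open V -> B0 B ->
  measurable (V `*` B : set (borel (X * Y)%type)).
Proof. by move=> oV mB; apply: measurable_open_rectangle => //;
  exact: B0_borel. Qed.

Let measurable_closed_rectangle K B : closed K -> B0 B ->
  measurable (K `*` B : set (borel (X * Y)%type)).
Proof.
move=> cK mB; rewrite (_ : K `*` B = (setT `*` B) `\` (~` K `*` B)).
  apply: measurableD; apply: measurable_B0_rectangle => //; first exact: openT.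
  exact: closed_openC.
apply/seteqP; split=> [[x y] /= [Kx By]|[x y] /= [[_ By]
  /not_andP[/contrapT//|//]]].
by split => // -[].
Qed.

Let open_preimage_rectangle_le (h : X -> X) V B r :
  continuous h -> open V -> B0 B ->
  (forall U K, open U -> closed K -> U `<=` K -> K `<=` V ->
    (lam ((h @^-1` U) `*` B) <= r)%E) -> (lam ((h @^-1` V) `*` B) <= r)%E.
Proof.
move=> ch oV mB UKr.
have [U [K [oU cK UKV ndU capU]]] := open_inner_approximation oV.
have ohU j : open (h @^-1` U j).
  by apply: open_comp (oU j) => x _; exact: ch.
have UVB : (h @^-1` V) `*` B = \bigcup_j ((h @^-1` U j) `*` B).
  rewrite -capU; apply/seteqP;
    split=> [[x y] [[j _ Ux] By]|[x y] [j _ [Ux By]]].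
    by exists j.
  by split => //; exists j.
have cvgU : lam \o (fun j => (h @^-1` U j) `*` B) @ \oo -->
    lam (\bigcup_j ((h @^-1` U j) `*` B)).
  apply: nondecreasing_cvg_mu => [j||].
  - exact: measurable_B0_rectangle.
  - by apply: bigcupT_measurable => j; exact: measurable_B0_rectangle.
  - move=> i j ij; rewrite subsetEset => -[x y] [Ux By]; split => //.
    by have := ndU _ _ ij; rewrite subsetEset; exact.
rewrite UVB; apply: (cvge_to_le cvgU); apply: nearW => j /=.
by have [? ?] := UKV j; exact: (UKr _ (K j)).
Qed.

Let preimage_rectangle V B :
  prod_map S T @^-1` (V `*` B) = (S @^-1` V) `*` (T @^-1` B).
Proof. by []. Qed.

Let openS V : open V -> open (S @^-1` V).
Proof. by move=> oV; apply: open_comp oV => x _; exact: contS. Qed.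

Let closedS K : closed K -> closed (S @^-1` K).
Proof. by move=> cK; apply: closed_comp cK => x _; exact: contS. Qed.

(** [M] is invariant on all sets; squeezing a closed set between an open set and
    each of its open inner approximations carries this over to [lam], although
    [lam] and [M] may differ on open sets. *)
Let invariant_rectangle V B : open V -> B0 B ->
  lam (prod_map S T @^-1` (V `*` B)) = lam (V `*` B).
Proof.
move=> oV mB; rewrite preimage_rectangle; apply/eqP; rewrite eq_le.
apply/andP; split.
  apply: open_preimage_rectangle_le => // [|U K oU cK UK KV]; first exact: B0T.
  apply: (le_trans (open_rectangle_le_mean (openS oU) (B0T mB))).
  rewrite -preimage_rectangle M_invariant.
  apply: (@le_trans _ _ (M (K `*` B))%:E).
    by rewrite lee_fin; apply: (le_mean meanM) => -[x y] [Ux By]; split => //;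
      exact: UK.
  apply: (le_trans (mean_le_closed_rectangle cK mB)).
  apply: le_measure; rewrite ?inE.
  - exact: measurable_closed_rectangle.
  - exact: measurable_B0_rectangle.
  - by move=> [x y] [Kx By]; split => //; exact: KV.
apply: (@open_preimage_rectangle_le id) => // [x|U K oU cK UK KV].
  exact: cvg_id.
apply: (le_trans (open_rectangle_le_mean oU mB)).
rewrite -M_invariant preimage_rectangle.
apply: (@le_trans _ _ (M ((S @^-1` K) `*` (T @^-1` B)))%:E).
  by rewrite lee_fin; apply: (le_mean meanM) => -[x y] [Ux By]; split => //;
    exact: UK.
apply: (le_trans (mean_le_closed_rectangle (closedS cK) (B0T mB))).
apply: le_measure; rewrite ?inE.
- exact: measurable_closed_rectangle (closedS cK) (B0T mB).
- exact: measurable_B0_rectangle (openS oV) (B0T mB).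
- by move=> [x y] [Kx By]; split => //; exact: KV.
Qed.

Let B0_rectangles : set (set (X * Y)) :=
  [set C | exists V B, [/\ open V, B0 B & C = V `*` B]].

Lemma invariant_of_mean :
  invariant_measure (prod_map S T : borel (X * Y)%type ->
    borel (X * Y)%type) lam.
Proof.
move=> A mA; pose q : borel (X * Y)%type -> borel (X * Y)%type := prod_map S T.
pose mfun_q : {mfun _ >-> _} :=
  HB.pack q (isMeasurableFun.Build _ _ _ _ _
    (measurable_prod_map baseb contS measT)).
apply: (@measure_unique _ R (borel (X * Y)%type) B0_rectangles (fun=> setT)
  _ _ _ _ (distribution lam mfun_q) lam) => //.
- apply/seteqP; split; apply: smallest_sub.
  + exact: smallest_sigma_algebra.
  + move=> W oW; rewrite (open_bigcup_rectangles baseb oW).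
    apply: sigma_algebra_bigcup => i; apply: sub_sigma_algebra.
    by exists (tube b W i), (b i); split => //; exact: open_interior.
  + exact: sigma_algebra_measurable.
  + by move=> _ [V [B [oV mB ->]]]; exact: measurable_B0_rectangle.
- move=> _ _ [V [B [oV mB ->]]] [V' [B' [oV' mB' ->]]].
  exists (V `&` V'), (B `&` B'); split; first exact: openI.
    by rewrite -[B `&` B']setCK setCI; apply: B0C; apply: B0U; exact: B0C.
  by rewrite setXI.
- by move=> _; exists setT, setT; split; [exact: openT|by []|rewrite setXTT].
- by rewrite bigcup_const//; exists 0%N.
- by move=> _ [V [B [oV mB ->]]]; exact: invariant_rectangle.
- by move=> _; rewrite /= probability_setT ltry.
Qed.

Lemma joining_of_mean : joinings S T nu lam.
Proof. by split; [exact: invariant_of_mean|exact: marginal_of_mean]. Qed.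

End joining.
End borel_measure_of_mean.

(** * Means of orbit segments *)

Lemma iter_prod_map (X Y : Type) (S : X -> X) (T : Y -> Y) k x y :
  iter k (prod_map S T) (x, y) = (iter k S x, iter k T y).
Proof. by elim: k => //= k ->. Qed.

(** The sequence has a cluster point along [U] by compactness, and along an
    ultrafilter a cluster point is a limit. *)
Lemma ultra_cvg_segment (R : realType) (U : set_system nat)
    (u : nat -> R) (a c : R) :
  UltraFilter U -> (forall n, a <= u n <= c) ->
    exists r : R, u n @[n --> U] --> r.
Proof.
move=> uU ua; have PU : ProperFilter (u @ U) by exact: fmap_proper_filter.
have : (u @ U) `[a, c]%classic.
  by apply: nearW => n /=; rewrite in_itv/= ua.
move=> /(@segment_compact R a c _ PU)[r [_ clr]].
exists r => V Vr; have [//|UV] := @in_ultra_setVsetC _ _ (u @^-1` V) uU.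
have [w [Vw]] := clr (~` V) V UV Vr.
by [].
Qed.

Section orbit_mean.
Context (R : realType) (X Y : Type) (S : X -> X) (T : Y -> Y).
Variables (x : nat -> X) (y : Y) (U : set_system nat).
Hypotheses (uU : UltraFilter U) (ooU : \oo `<=` U).

(** The starting point depends on the length [n] of the orbit segment: it will
    be a near minimiser of the average of that length. *)
Definition visit_frequency (n : nat) (E : set (X * Y)) : R :=
  n%:R^-1 * birkhoff_sum (prod_map S T) \1_E n (x n, y).

Let PU : ProperFilter U := ultra_proper.

Lemma visit_frequency_ge0 n E : 0 <= visit_frequency n E.
Proof.
by rewrite mulr_ge0 ?invr_ge0// sumr_ge0// => k _; rewrite indicE.
Qed.

Lemma visit_frequency_le1 n E : visit_frequency n E <= 1.
Proof.
case: n => [|n]; first by rewrite /visit_frequency invr0 mul0r.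
rewrite /visit_frequency ler_pdivrMl ?ltr0n// mulr1.
apply: (@le_trans _ _ (\sum_(k < n.+1) 1)); last by rewrite sumr_const card_ord.
by apply: ler_sum => k _; rewrite indicE lern1 leq_b1.
Qed.

Definition orbit_mean (E : set (X * Y)) : R :=
  lim (visit_frequency n E @[n --> U]).

Lemma cvg_visit_frequency E : visit_frequency n E @[n --> U] --> orbit_mean E.
Proof.
apply/cvg_ex/ (ultra_cvg_segment (a := 0) (c := 1) uU) => n.
by rewrite visit_frequency_ge0 visit_frequency_le1.
Qed.

Lemma orbit_mean_eq E r :
  visit_frequency n E @[n --> \oo] --> r -> orbit_mean E = r.
Proof.
move=> Er; apply: (@cvg_unique _ _ (visit_frequency n E @[n --> U])) => //.
  exact: cvg_visit_frequency.
by move=> V /Er; exact: ooU.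
Qed.

Lemma mean_orbit_mean : mean orbit_mean.
Proof.
split=> [E||E F EF].
- apply: limr_ge; first by apply/cvg_ex; eexists; exact: cvg_visit_frequency.
  by apply: nearW => n; exact: visit_frequency_ge0.
- apply: orbit_mean_eq; apply: cvg_near_cst; exists 1%N => // n /= n0.
  rewrite /visit_frequency /birkhoff_sum;
    under eq_bigr do rewrite indicE in_setT.
  by rewrite sumr_const card_ord mulVf// pnatr_eq0 -lt0n.
- apply: (@cvg_unique _ _ (visit_frequency n (E `|` F) @[n --> U])) => //.
    exact: cvg_visit_frequency.
  rewrite (_ : (fun n => _) = fun n =>
    visit_frequency n E + visit_frequency n F).
    by apply: cvgD; exact: cvg_visit_frequency.
  apply/funext => n; rewrite /visit_frequency -mulrDr -big_split/=;
    congr (_ * _).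
  apply: eq_bigr => k _; rewrite !indicE in_setU.
  have [Ew|_] := boolP (_ \in E); have [Fw|_] := boolP (_ \in F);
    rewrite ?addr0 ?add0r//.
  exfalso.
  suff : (E `&` F) (iter k (prod_map S T) (x n, y)) by rewrite EF.
  by split; [exact: set_mem Ew|exact: set_mem Fw].
Qed.

(** Shifting the orbit segment by one step changes the frequency by its two end
    terms only, that is by at most [1 / n]. *)
Lemma orbit_mean_invariant E : orbit_mean (prod_map S T @^-1` E) = orbit_mean E.
Proof.
apply: (@cvg_unique _ _ (visit_frequency n (prod_map S T @^-1` E) @[n --> U]))
  => //.
  exact: cvg_visit_frequency.
pose err n : R := n%:R^-1 * (\1_E (iter n (prod_map S T) (x n,
  y)) - \1_E (x n, y)).
rewrite (_ : (fun n => _) = fun n => visit_frequency n E + err n).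
  rewrite -[orbit_mean E]addr0; apply: cvgD; first exact: cvg_visit_frequency.
  apply/cvgr0Pnorm_le => e e0; apply: ooU.
  have [m _ me] := near_infty_natSinv_lt (PosNum e0).
  exists m.+1 => // -[//|n] /= mn; have := me n mn => /ltW; apply: le_trans.
  rewrite /err normrM ger0_norm ?invr_ge0// ler_piMr ?invr_ge0//.
  by rewrite !indicE; case: (_ \in _); case: (_ \in _);
     rewrite ?subrr ?subr0 ?sub0r ?normrN ?normr0 ?normr1.
apply/funext => n; rewrite /visit_frequency /err -mulrDr; congr (_ * _).
set w := (x n, y); set f := prod_map S T.
apply: (@addrI _ (\1_E w)); rewrite addrCA subrKC.
rewrite (_ : \1_(f @^-1` E) = \1_E \o f); last first.
  by apply/funext => v; rewrite /= !indicE; congr (_%:R); apply/idP/idP;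
    rewrite !inE.
rewrite (_ : birkhoff_sum f (\1_E \o f) n w = birkhoff_sum f \1_E n (f w)).
  by rewrite -birkhoff_sumS /birkhoff_sum big_ord_recr.
by apply: eq_bigr => k _; rewrite /= -iterS iterSr.
Qed.

End orbit_mean.

(** * The joining of a generic orbit *)

(** The step functions that count how many multiples of the step [e] lie below
    the value [v] approximate [v] within [e] once there are enough of them; both
    bounds are by induction on the number of steps. *)
Lemma layers_le (R : realType) (v e : R) N : 0 <= v -> 0 < e ->
  \sum_(j < N) e * (j.+1%:R * e < v)%R%:R <= v.
Proof.
move=> v0 e0.
suff : \sum_(j < N) e * (j.+1%:R * e < v)%R%:R <= v /\
       \sum_(j < N) e * (j.+1%:R * e < v)%R%:R <= N%:R * e by case.
elim: N => [|N [IHv IHN]]; first by rewrite big_ord0 mul0r.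
rewrite big_ord_recr/= -natr1; have [h|_] := ltP ((N%:R + 1) * e) v.
  by rewrite mulr1; split; lra.
by rewrite mulr0 addr0; split => //; lra.
Qed.

Lemma le_layers (R : realType) (v e : R) N : 0 < e -> v <= N%:R * e ->
  v <= e + \sum_(j < N) e * (j.+1%:R * e < v)%R%:R.
Proof.
move=> e0 vN.
suff [//|le] : v <= e + \sum_(j < N) e * (j.+1%:R * e < v)%R%:R \/
       N.+1%:R * e <= e + \sum_(j < N) e * (j.+1%:R * e < v)%R%:R.
  by apply: le_trans le; move: vN; rewrite -natr1; lra.
elim: N {vN} => [|N [IH|IH]]; first by right; rewrite big_ord0 addr0 mul1r.
  left; rewrite big_ord_recr/= addrA; apply: (le_trans IH).
  by rewrite lerDl mulr_ge0// ltW.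
rewrite big_ord_recr/=; have [h|h] := ltP (N.+1%:R * e) v; [right|left].
  by move: IH; rewrite mulr1 -(natr1 N.+1); lra.
by rewrite mulr0 addr0 (le_trans h).
Qed.

(** Bounding an integral through finitely many superlevel sets at a time makes
    it accessible to a mean, which controls single sets but not limits. *)
Lemma integral_le_layers d (Z : measurableType d) (R : realType)
    (P : probability Z R) (f : Z -> R) (C : R) :
  measurable_fun setT f -> (forall z, 0 <= f z) ->
  (forall k N : nat, (\sum_(j < N)
     (k.+1%:R^-1)%:E * P [set z | (j.+1%:R * k.+1%:R^-1 < f z)%R] <= C%:E)%E) ->
  (\int[P]_z (f z)%:E <= C%:E)%E.
Proof.
move=> mf f0 layC.
have le_k k : (\int[P]_z (f z)%:E <= (C + k.+1%:R^-1)%:E)%E.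
  set e : R := k.+1%:R^-1; have e0 : 0 < e by rewrite invr_gt0.
  pose A j := [set z | j.+1%:R * e < f z].
  have mA j : measurable (A j) by exact: measurable_superlevel.
  have mh j : measurable_fun setT (fun z => (e * \1_(A j) z)%:E).
    apply/measurable_EFinP; apply: measurable_funM => //.
  have h0 j z : (0 <= (e * \1_(A j) z)%:E)%E by rewrite lee_fin mulr_ge0// ltW.
  apply: (@le_trans _ _ (\int[P]_z (e%:E + \sum_(j <oo) (e * \1_(A j)
    z)%:E))%E).
    apply: ge0_le_integral => //.
    - by move=> z _; rewrite lee_fin.
    - exact/measurable_EFinP.
    - by apply: emeasurable_funD => //; exact: ge0_emeasurable_sum.
    - move=> z _; have [N _ /(_ N (leqnn N)) fN] := nbhs_infty_ger (f z / e).
      move: fN; rewrite /= ler_pdivrMr// => /(le_layers e0) fN.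
      apply: (@le_trans _ _ (e%:E + \sum_(0 <= j < N) (e * \1_(A j) z)%:E)%E).
        rewrite sumEFin -EFinD lee_fin (le_trans fN)// lerD2l big_mkord.
        by apply: ler_sum => j _; rewrite indicE /A mem_setE.
      by rewrite leeD2l// nneseries_lim_ge.
  rewrite ge0_integralD//=; last 3 first.
  - by move=> z _; rewrite lee_fin ltW.
  - by move=> z _; rewrite nneseries_ge0.
  - by apply: ge0_emeasurable_sum.
  rewrite integral_nneseries//.
  rewrite [X in (X + _)%E](_ : _ = e%:E); last first.
    by have := @integral_cst _ _ _ P [set: Z] measurableT e%:E;
       rewrite /= probability_setT mule1.
  rewrite addeC EFinD leeD2r//.
  under eq_eseriesr => j _.
    rewrite (_ : \int[P]_x (e * \1_(A j) x)%:E = e%:E * P (A j))%E; last first.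
      under eq_integral do rewrite EFinM.
      rewrite integralZl//; last exact: integrable_indic.
      by rewrite integral_indic// setIT.
    over.
  apply: lime_le.
    by apply: is_cvg_nneseries => j _ _; rewrite mule_ge0// lee_fin ltW.
  by apply: nearW => N; rewrite big_mkord; exact: layC.
apply/lee_addgt0Pr => e e0.
have [k _ /(_ k (leqnn k)) ke] := near_infty_natSinv_lt (PosNum e0).
by apply: (le_trans (le_k k)); rewrite -EFinD lee_fin lerD2l ltW.
Qed.

Section joining_of_orbit.
Context (R : realType) (X : pmetricType R) (Y : ptopologicalType).
Variables (S : X -> X) (T : Y -> Y) (l : X * Y -> R) (lstar : Y -> R).
Variables (B0 : set (set Y)) (b : nat -> set Y).
Hypothesis compactX : compact [set: X].
Hypothesis contS : continuous S.
Hypothesis measT : measurable_fun setT (T : borel Y -> borel Y).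
Hypothesis open_l : forall q, open [set z | q < l z].
Hypothesis lbound : forall z, `|l z| <= lstar z.2.
Hypotheses (B00 : B0 set0) (B0U : setU_closed B0) (B0C : setC_closed B0).
Hypothesis B0_borel : forall B, B0 B -> measurable (B : set (borel Y)).
Hypotheses (baseb : is_base b) (B0b : forall i, B0 (b i)).
Hypothesis B0T : forall B, B0 B -> B0 (T @^-1` B).
Hypothesis B0_lstar : forall q : rat, B0 [set y | ratr q < lstar y].

(** The sum exceeds [r] exactly when some rational [q] separates the two terms:
    [q < l] holds on rectangles by semicontinuity, and [r - q < lstar] depends
    on [y] alone. *)
Lemma superlevel_rectangles (r : rat) :
  exists (V : nat -> set X) (B : nat -> set Y),
  [/\ forall i, open (V i), forall i, B0 (B i) &
      [set z | ratr r < l z + lstar z.2] = \bigcup_i (V i `*` B i)].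
Proof.
pose V i := if @unpickle (rat * nat)%type i is Some (q, j)
  then tube b [set z | ratr q < l z] j else set0.
pose B i := if @unpickle (rat * nat)%type i is Some (q, j)
  then b j `&` [set y | ratr (r - q) < lstar y] else set0.
exists V, B; split.
- move=> i; rewrite /V; case: unpickle => [[q j]|]; last exact: open0.
  exact: open_interior.
- move=> i; rewrite /B; case: unpickle => [[q j]|] //.
  rewrite -[_ `&` _]setCK setCI; apply: B0C; apply: B0U; apply: B0C.
    exact: B0b.
  exact: B0_lstar.
apply/seteqP; split=> [[x y] /= lr|[x y] [i _]].
  have [q] : exists q : rat, ratr q \in `](ratr r - lstar y), (l (x, y))[.
    by apply: rat_in_itvoo; rewrite ltrBlDr.
  rewrite in_itv/= => /andP[rq ql].
  have : [set z | ratr q < l z] (x, y) by [].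
  rewrite {1}(open_bigcup_rectangles baseb (@open_l (ratr q))) =>
    -[j _ [Vx By]].
  have [i iK] : exists i, unpickle i = Some (q, j).
    by exists (pickle (q, j)); exact: pickleK.
  exists i => //; rewrite /V /B iK; split => //=.
  by split => //=; rewrite rmorphB/=; lra.
rewrite /V /B; case: unpickle => [[q j]|] [//= /interior_subset/= Vx [/Vx]].
by rewrite rmorphB/=; lra.
Qed.

Let measurable_l : measurable_fun setT (l : borel (X * Y)%type -> R).
Proof.
apply: (@measurability _ _ _ _ _ _ _ (RGenOInfty.measurableE R)) => //.
move=> _ [_ [q ->] <-]; rewrite setTI preimage_itvoy.
by apply: sub_sigma_algebra; exact: open_l.
Qed.

Variable nu : probability (borel Y) R.
Hypothesis lstarL1 : nu.-integrable setT (fun y : borel Y => (lstar y)%:E).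

Lemma integrable_joining (lam : probability (borel (X * Y)%type) R) :
  joinings S T nu lam ->
  [/\ lam.-integrable setT (fun z : borel (X * Y)%type => (l z)%:E),
      lam.-integrable setT (fun z : borel (X * Y)%type => (lstar z.2)%:E) &
      (\int[lam]_z (lstar z.2)%:E = \int[nu]_y (lstar y)%:E)%E].
Proof.
move=> [_ marg].
have [intlstar eqlstar] := integral_measure_preserving
  (@measurable_snd_borel X Y) marg lstarL1.
split => //; apply: le_integrable intlstar => //; first exact/measurable_EFinP.
by move=> z _ /=; rewrite lee_fin (le_trans (lbound z))// ler_norm.
Qed.

Variables (x : nat -> X) (y : Y) (U : set_system nat).
Hypotheses (uU : UltraFilter U) (ooU : \oo `<=` U).
Hypothesis generic : forall B, B0 B ->
  n%:R^-1 * birkhoff_sum T \1_B n y @[n --> \oo] --> fine (nu B).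
Hypothesis generic_lstar :
  n%:R^-1 * birkhoff_sum T lstar n y @[n --> \oo] -->
  fine (\int[nu]_y (lstar y)%:E).

Let M := orbit_mean R S T x y U.

Let M_marginal B : B0 B -> (M [set w | B w.2])%:E = nu B.
Proof.
move=> mB; rewrite /M (orbit_mean_eq uU ooU (r := fine (nu B))).
  by rewrite fineK// fin_num_measure//; exact: B0_borel.
rewrite (_ : (fun n => _) = fun n => n%:R^-1 * birkhoff_sum T \1_B n y).
  exact: generic.
apply/funext => n; congr (_ * _); apply: eq_bigr => k _.
by rewrite iter_prod_map !indicE; congr (_%:R); apply/idP/idP; rewrite !inE.
Qed.

Let psi z := l z + lstar z.2.

Let psi_ge0 z : 0 <= psi z.
Proof. by have := lbound z; rewrite ler_norml /psi => /andP[]; lra. Qed.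

(** Along each orbit segment the step functions lie below [l + lstar], and the
    averages of [lstar] converge because [y] is generic. *)
Lemma orbit_mean_layers a (e : R) N : 0 < e ->
  (\forall n \near U, ergodic_average S T l n (x n) y <= a) ->
  \sum_(j < N) e * M [set z | j.+1%:R * e < psi z] <=
  a + fine (\int[nu]_y (lstar y)%:E).
Proof.
move=> e0 avga; have PU : ProperFilter U := ultra_proper.
pose A j := [set z | j.+1%:R * e < psi z].
have cvg_layers : \sum_(j < N) e * visit_frequency R S T x y n (A j) @[n --> U]
    --> \sum_(j < N) e * M (A j).
  apply: cvg_big => [|j _]; first exact: add_continuous.
  by apply: cvgMl_tmp; exact: cvg_visit_frequency.
have cvg_lstar : a + n%:R^-1 * birkhoff_sum T lstar n y @[n --> U] -->
    a + fine (\int[nu]_y (lstar y)%:E).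
  apply: cvgD; first exact: cvg_cst.
  by move=> V /generic_lstar; exact: ooU.
apply: (ler_cvg_to cvg_layers cvg_lstar).
near=> n.
have avgn : ergodic_average S T l n (x n) y <= a by near: n.
apply: (@le_trans _ _ (ergodic_average S T l n (x n) y +
    n%:R^-1 * birkhoff_sum T lstar n y)); last by rewrite lerD2r.
rewrite /ergodic_average /visit_frequency /birkhoff_sum -mulrDr -big_split/=.
under eq_bigr do rewrite mulrCA.
rewrite -mulr_sumr ler_wpM2l ?invr_ge0//.
under [leLHS]eq_bigr do rewrite mulr_sumr.
rewrite exchange_big/=; apply: ler_sum => k _.
have := layers_le N (psi_ge0 (iter k (prod_map S T) (x n, y))) e0.
rewrite iter_prod_map; apply: le_trans; apply: ler_sum => j _.
by rewrite indicE /A mem_setE.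
Unshelve. all: end_near. Qed.

(** The orbits of the points [x n] over a single generic [y] suffice to produce
    a joining: the measure below their mean is invariant, has marginal [nu], and
    inherits the bound on [l] because the superlevel sets of [l + lstar] are of
    the kind on which the measure is at most the mean. *)
Lemma joining_of_orbit : exists2 lam : probability (borel (X * Y)%type) R,
  joinings S T nu lam &
  forall a, (\forall n \near U, ergodic_average S T l n (x n) y <= a) ->
    (\int[lam]_z (l z)%:E <= a%:E)%E.
Proof.
have meanM : mean M by exact: mean_orbit_mean.
have [lam lamM] := borel_measure_of_mean compactX B00 B0U B0C B0_borel baseb B0b
  meanM M_marginal.
have joinlam : joinings S T nu lam.
  apply: (joining_of_mean B00 B0U B0C B0_borel baseb B0b meanM M_marginal contS
    measT B0T) => //.
  by move=> E; exact: orbit_mean_invariant.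
exists lam => // a avga.
have [intl intlstar eqlstar] := integrable_joining joinlam.
have intpsi : (\int[lam]_z (psi z)%:E <=
    (a + fine (\int[nu]_y (lstar y)%:E))%:E)%E.
  apply: integral_le_layers => //.
    apply: measurable_funD => //.
    by apply/measurable_EFinP; exact: measurable_int intlstar.
  move=> k N; have k0 : 0 < k.+1%:R^-1 :> R by rewrite invr_gt0.
  apply: le_trans (_ : (\sum_(j < N) k.+1%:R^-1 * M [set z | j.+1%:R *
    k.+1%:R^-1 < psi z])%:E <= _)%E; last first.
    by rewrite lee_fin; exact: orbit_mean_layers.
  rewrite -sumEFin; apply: lee_sum => j _; rewrite EFinM lee_pmul2l//.
  have [V [B [oV mB ->]]] : exists (V : nat -> set X) (B : nat -> set Y),
      [/\ forall i, open (V i), forall i, B0 (B i) &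
      [set z | j.+1%:R * k.+1%:R^-1 < psi z] = \bigcup_i (V i `*` B i)].
    have := superlevel_rectangles (j.+1%:R / k.+1%:R).
    by rewrite fmorph_div/= !ratr_nat.
  exact: lamM.
move: intpsi; under eq_integral do rewrite EFinD.
rewrite integralD// eqlstar EFinD fineK; last exact: integrable_fin_num lstarL1.
by rewrite leeD2rE// integrable_fin_num.
Qed.

End joining_of_orbit.

(** * Measurability of the infimal sums *)

Section measurable_infimum.
Context (R : realType) (X : pmetricType R) (Y : ptopologicalType).
Variables (S : X -> X) (T : Y -> Y) (l : X * Y -> R) (lstar : Y -> R).
Variable b : nat -> set Y.
Hypothesis compactX : compact [set: X].
Hypothesis contS : continuous S.
Hypothesis measT : measurable_fun setT (T : borel Y -> borel Y).
Hypothesis open_l : forall q, open [set z | q < l z].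
Hypothesis lbound : forall z, `|l z| <= lstar z.2.
Hypothesis baseb : is_base b.

Let F := prod_map S T.

Definition infimal_sum (n : nat) (y : Y) : R :=
  inf [set birkhoff_sum F l n (x, y) | x in [set: X]].

Lemma birkhoff_sum_bound n z :
  `|birkhoff_sum F l n z| <= birkhoff_sum T lstar n z.2.
Proof.
apply: (le_trans (ler_norm_sum _ _ _)); apply: ler_sum => k _.
by case: z => x y; rewrite (le_trans (lbound _))// iter_prod_map.
Qed.

Lemma has_inf_birkhoff_sum n y :
  has_inf [set birkhoff_sum F l n (x, y) | x in [set: X]].
Proof.
split; first by exists (birkhoff_sum F l n (point, y)), point.
exists (- birkhoff_sum T lstar n y) => _ [x _ <-].
by have := birkhoff_sum_bound n (x, y); rewrite ler_norml => /andP[].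
Qed.

Lemma infimal_sum_le n z : infimal_sum n z.2 <= birkhoff_sum F l n z.
Proof.
case: z => x y; apply: ge_inf; first exact: (has_inf_birkhoff_sum n y).2.
by exists x.
Qed.

Lemma le_infimal_sum n y a :
  (forall x, a <= birkhoff_sum F l n (x, y)) -> a <= infimal_sum n y.
Proof.
move=> ale; apply: lb_le_inf; first exact: (has_inf_birkhoff_sum n y).1.
by move=> _ [x _ <-].
Qed.

Lemma infimal_sum_superadditive n y :
  - lstar y + infimal_sum n (T y) <= infimal_sum n.+1 y.
Proof.
apply: le_infimal_sum => x; rewrite birkhoff_sumS; apply: lerD.
  by have := lbound (x, y); rewrite ler_norml => /andP[].
exact: (infimal_sum_le n (S x, T y)).
Qed.

Lemma inf_averageE n y :
  inf_average S T l n y = (n%:R^-1 * infimal_sum n y)%:E.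
Proof.
have avgE x : ergodic_average S T l n x y = n%:R^-1 * birkhoff_sum F l n (x, y).
  by congr (_ * _); apply: eq_bigr => k _; rewrite iter_prod_map.
apply/eqP; rewrite eq_le; apply/andP; split; last first.
  apply: le_ereal_inf_tmp => _ [x _ <-]; rewrite lee_fin avgE.
  by rewrite ler_wpM2l ?invr_ge0//; exact: (infimal_sum_le n (x, y)).
apply/lee_addgt0Pr => e e0.
have [_ [x _ <-] lex] := inf_adherent e0 (has_inf_birkhoff_sum n y).
apply: (@le_trans _ _ (ergodic_average S T l n x y)%:E).
  by apply: ereal_inf_lbound; exists x.
rewrite avgE -EFinD lee_fin; case: n lex {avgE} => [|n] lex.
  by rewrite invr0 !mul0r add0r ltW.
rewrite ler_pdivrMl ?ltr0n// mulrDr mulVKf ?pnatr_eq0//.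
apply: (le_trans (ltW lex)); rewrite lerD2l ler_peMl ?ler1n//.
exact: ltW.
Qed.

(** A box assigns to each time [k] a rational [q_k] and a basic open set
    [b i_k]. If [x] satisfies [certified] and [y] satisfies [visits], then
    [l (S^k x, T^k y)] exceeds [q_k] for every [k], so the Birkhoff sum at
    [(x, y)] exceeds the sum of the [q_k]. *)
Let box n := {ffun 'I_n -> rat * nat}.

Let certified n (d : box n) (x : X) : Prop :=
  forall (k : 'I_n) y, b (d k).2 y -> ratr (d k).1 < l (iter k S x, y).

Let visits n (d : box n) : set Y := [set y | forall k :
  'I_n, b (d k).2 (iter k T y)].

Let large n c (d : box n) : Prop := c < \sum_(k < n) ratr (d k).1 :> R.

Let continuous_iter k : continuous (iter k S).
Proof.
elim: k => [|k IH] x; first exact: cvg_id.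
by apply: continuous_comp; [exact: IH|exact: contS].
Qed.

Let local_certificate n c y x : c < birkhoff_sum F l n (x, y) ->
  exists d : box n, [/\ large c d, visits d y & nbhs x (certified d)].
Proof.
(* Rationals within [e] of the [n] summands lose less than the gap above [c]
   in total, as [n * e] is less than the gap. *)
move=> clt; pose e := (birkhoff_sum F l n (x, y) - c) / n.+1%:R.
have e0 : 0 < e by rewrite divr_gt0 ?subr_gt0.
pose v (k : 'I_n) := l (iter k S x, iter k T y).
have /choice[q qv] (k : 'I_n) : exists q : rat, ratr q \in `](v k - e), (v k)[.
  by apply: rat_in_itvoo; rewrite ltrBlDr ltrDl.
have /choice[i iP] (k : 'I_n) : exists i, b i (iter k T y) /\
    nbhs x [set x' | forall y', b i y' -> ratr (q k) < l (iter k S x', y')].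
  have [[V W] /= [Vx Wy] VW] :
      nbhs (iter k S x, iter k T y) [set z | ratr (q k) < l z].
    apply: open_nbhs_nbhs; split; first exact: open_l.
    by have := qv k; rewrite in_itv/= => /andP[].
  have [i biy biW] := baseb.2 _ _ Wy; exists i; split => //.
  have : nbhs x (iter k S @^-1` V) by exact: (@continuous_iter k x _ Vx).
  apply: filterS => x' Vx' y' biy'.
  by apply: (VW (iter k S x', y')); split => //; exact: biW.
exists [ffun k => (q k, i k)]; split.
- have -> : c = birkhoff_sum F l n (x, y) - n.+1%:R * e.
    by rewrite /e mulrC divfK ?pnatr_eq0// opprB subrKC.
  apply: (@lt_le_trans _ _ (birkhoff_sum F l n (x, y) - n%:R * e)).
    by rewrite ltrD2l ltrN2 ltr_pM2r// ltr_nat.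
  rewrite (_ : birkhoff_sum F l n (x, y) - n%:R * e = \sum_(k < n) (v k - e)).
    apply: ler_sum => k _; rewrite ffunE.
    by have := qv k; rewrite in_itv/= => /andP[/ltW].
  rewrite sumrB sumr_const card_ord mulr_natl; congr (_ - _).
  by apply: eq_bigr => k _; rewrite iter_prod_map.
- by move=> k; rewrite ffunE; exact: (iP k).1.
- have : nbhs x (fun x' => forall k : 'I_n, forall y', b (i k) y' ->
      ratr (q k) < l (iter k S x', y')).
    by apply: filter_forall => k; exact: (iP k).2.
  by apply: filterS => x' cx' k y'; rewrite ffunE; exact: cx'.
Qed.

Let measurable_visits n (d : box n) : measurable (visits d : set (borel Y)).
Proof.
rewrite (_ : visits d =
    \bigcap_(k in [set: 'I_n]) (iter k T @^-1` b (d k).2)).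
  apply: fin_bigcap_measurable => [|k _]; first exact: finite_finset.
  apply: (@measurable_iter_preimage _ (borel Y) T) => //.
  by apply: sub_sigma_algebra; exact: baseb.1.
by apply/seteqP; split=> y yd k; [move=> _; exact: yd|exact: yd].
Qed.

(** By compactness of [X] finitely many certificates suffice, and there are only
    countably many finite families of certificates. *)
Let measurable_birkhoff_gt n c :
  measurable ([set y | forall x, c < birkhoff_sum F l n (x, y)] :
    set (borel Y)).
Proof.
pose covering (D : seq (box n)) := (forall d, d \in D -> large c d) /\
  forall x, exists2 d, d \in D & certified d x.
rewrite (_ : [set y | _] = \bigcup_(D : seq (box n))
    (if `[< covering D >] then \bigcap_(d in [set` D]) visits d else set0)).
  apply: countable_bigcupT_measurable => [|D]; first exact: countableP.
  case: ifP => _ //.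
  by apply: fin_bigcap_measurable => // d _; exact: measurable_visits.
apply/seteqP; split=> [y ylarge|y [D _ + x]].
  pose good := [set d : box n | large c d /\ visits d y].
  have := compactX; rewrite compact_cover.
  move=> /(_ (box n) good (fun d => interior (certified d))).
  case=> [d _|x _|D Dgood Dcover].
  - exact: open_interior.
  - by have [d [? ? ?]] := local_certificate (ylarge x); exists d.
  exists (finmap.enum_fset D) => //; case: asboolP => [_ d /= dD|[]].
    by have /set_mem[] := Dgood _ dD.
  split=> [d dD|x]; first by have /set_mem[] := Dgood _ dD.
  by have [d dD /interior_subset] := Dcover x I; exists d.
case: asboolP => // -[Dlarge Dcert] /= yD; have [d dD dx] := Dcert x.
apply: (lt_le_trans (Dlarge _ dD)); apply: ler_sum => k _.
by rewrite iter_prod_map ltW//; apply: dx; exact: (yD _ dD).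
Qed.

Lemma measurable_infimal_sum n :
  measurable_fun setT (infimal_sum n : borel Y -> R).
Proof.
apply: (@measurability _ _ (borel Y) _ _ _ _ (RGenOInfty.measurableE R)) => //.
move=> _ [_ [c ->] <-]; rewrite setTI preimage_itvoy.
rewrite (_ : [set y | _] = \bigcup_m
    [set y | forall x, c + m.+1%:R^-1 < birkhoff_sum F l n (x, y)]).
  by apply: bigcupT_measurable => m; exact: measurable_birkhoff_gt.
apply/seteqP; split=> [y /= cy|y [m _ /= cm]]; last first.
  apply: (@lt_le_trans _ _ (c + m.+1%:R^-1)); first by rewrite ltrDl invr_gt0.
  by apply: le_infimal_sum => x; exact/ltW.
have cy0 : 0 < infimal_sum n y - c by rewrite subr_gt0.
have [m _ /(_ m (leqnn m)) /= mc] := near_infty_natSinv_lt (PosNum cy0).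
exists m => // x; apply: lt_le_trans (infimal_sum_le n (x, y)).
by rewrite -ltrBrDl.
Qed.

End measurable_infimum.

(** * Countable bases and countable algebras *)

Lemma polish_base (R : realType) (Y : ptopologicalType) :
  polish R Y -> exists b : nat -> set Y, is_base b.
Proof.
move=> [[D cD dD] [M [f [g [fK gK cf cg]]]]].
have [d Dd] : exists d : nat -> Y, D `<=` range d.
  have [->|/set0P[y0 Dy0]] := eqVneq D set0; first by exists (fun=> point).
  move/pfcard_geP: cD => [D0|[h]]; first by exists (fun=> point); rewrite D0.
  by exists h; move=> y Dy; have [i _ <-] := @surj _ _ _ _ h y Dy; exists i.
pose b i := if (unpickle i : option (nat * nat)) is Some (p, k)
  then f @^-1` (interior (ball (f (d p)) (k.+1%:R^-1 : R))) else set0.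
exists b; split=> [i|y V Vy].
  rewrite /b; case: unpickle => [[p k]|]; last exact: open0.
  by apply: open_comp (@open_interior _ _) => y _; exact: cf.
have [e /= e0 ballV] : nbhs_ball (f y) (g @^-1` V).
  by rewrite nbhs_ballE; apply: cg; rewrite fK.
have e20 : 0 < e / 2 by rewrite divr_gt0.
have [k _ /(_ k (leqnn k)) /= ke] := near_infty_natSinv_lt (PosNum e20).
have r0 : 0 < k.+1%:R^-1 / 2 :> R by rewrite divr_gt0// invr_gt0.
have [_ [[p _ <-] yp]] :
  (range d `&` f @^-1` (interior (ball (f y) (k.+1%:R^-1 / 2 : R)))) !=set0.
  have : (f @^-1` (interior (ball (f y) (k.+1%:R^-1 / 2 : R)))) !=set0.
    by exists y; rewrite /= /interior; exact: nbhsx_ballx.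
  move=> /dD; case=> [|z [Bz /Dd dz]]; last by exists z.
  by apply: open_comp (@open_interior _ _) => z _; exact: cf.
have [i iK] : exists i, unpickle i = Some (p, k).
  by exists (pickle (p, k)); exact: pickleK.
have pr : ball (f y) (k.+1%:R^-1 / 2 : R) (f (d p)) := interior_subset yp.
exists i; rewrite /b iK.
  apply/nbhs_ballP; exists (k.+1%:R^-1 / 2) => //= z yz.
  by rewrite [X in ball _ X](splitr _); apply: ball_triangle (ball_sym pr) yz.
move=> z /= /interior_subset pz; rewrite -(fK z); apply: ballV.
apply: (@le_ball _ _ _ (k.+1%:R^-1 / 2 + k.+1%:R^-1));
  last exact: ball_triangle pr pz.
by move: ke; set r := k.+1%:R^-1; lra.
Qed.

Section generated_algebra.
Context (I Y : Type) (leaf : I -> set Y) (T : Y -> Y).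

(** The algebra of sets generated by [leaf] under complement, union and
    preimage by [T], as the image of the countable type of trees that describe
    how its elements are built. *)
Fixpoint algebra_set (t : GenTree.tree I) : set Y :=
  match t with
  | GenTree.Leaf i => leaf i
  | GenTree.Node 0 [:: u] => ~` algebra_set u
  | GenTree.Node 1 [:: u; v] => algebra_set u `|` algebra_set v
  | GenTree.Node 2 [:: u] => T @^-1` algebra_set u
  | _ => set0
  end.

Definition generated_algebra : set (set Y) := range algebra_set.

Lemma generated_algebra0 : generated_algebra set0.
Proof. by exists (GenTree.Node 3 [::]). Qed.

Lemma generated_algebraU : setU_closed generated_algebra.
Proof. by move=> _ _ [t _ <-] [u _ <-]; exists (GenTree.Node 1 [:: t; u]). Qed.

Lemma generated_algebraC : setC_closed generated_algebra.
Proof. by move=> _ [t _ <-]; exists (GenTree.Node 0 [:: t]). Qed.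

Lemma generated_algebra_preimage B :
  generated_algebra B -> generated_algebra (T @^-1` B).
Proof. by move=> [t _ <-]; exists (GenTree.Node 2 [:: t]). Qed.

Lemma generated_algebra_leaf i : generated_algebra (leaf i).
Proof. by exists (GenTree.Leaf i). Qed.

Lemma generated_algebra_ind (P : set Y -> Prop) :
  (forall i, P (leaf i)) -> P set0 -> (forall A, P A -> P (~` A)) ->
  (forall A B, P A -> P B -> P (A `|` B)) -> (forall A, P A -> P (T @^-1` A)) ->
  forall B, generated_algebra B -> P B.
Proof.
move=> Pleaf P0 PC PU PT _ [t _ <-]; move: t; fix IH 1 => -[i|k s] /=.
  exact: Pleaf.
case: k s => [|[|[|k]]] [|u [|v [|w s]]] //=.
- exact: PC (IH u).
- exact: PU (IH u) (IH v).
- exact: PT (IH u).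
Qed.

End generated_algebra.

(** * The optimal joining *)

Lemma ae_exists d (Z : measurableType d) (R : realType) (P : probability Z R)
    (Q : Z -> Prop) : {ae P, forall z, Q z} -> exists z, Q z.
Proof.
move=> [A [mA PA QA]]; apply: contrapT => /forallNP nQ.
have AT : A = setT by apply/seteqP; split=> // z _; apply: QA; exact: nQ.
by move: PA; rewrite AT => /eqP; rewrite (probability_setT P) eqe oner_eq0.
Qed.

Section optimal_joining.
Context (R : realType) (X : pmetricType R) (Y : ptopologicalType).
Variables (S : X -> X) (T : Y -> Y) (l : X * Y -> R) (lstar : Y -> R).
Variables (nu : probability (borel Y) R) (b : nat -> set Y).
Hypothesis compactX : compact [set: X].
Hypothesis contS : continuous S.
Hypothesis measT : measurable_fun setT (T : borel Y -> borel Y).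
Hypothesis invT : invariant_measure (T : borel Y -> borel Y) nu.
Hypothesis ergT : ergodic (T : borel Y -> borel Y) nu.
Hypothesis open_l : forall q, open [set z | q < l z].
Hypothesis lbound : forall z, `|l z| <= lstar z.2.
Hypothesis lstarL1 : nu.-integrable setT (fun y : borel Y => (lstar y)%:E).
Hypothesis baseb : is_base b.

(** The algebra must contain a base, for the Borel structure, and the superlevel
    sets of [lstar], for the integral of [l + lstar]. Being countable it admits
    points that are generic for all of its elements at once. *)
Let leaf (i : nat + rat) : set Y :=
  match i with inl i => b i | inr q => [set y | ratr q < lstar y] end.

Let B0 : set (set Y) := generated_algebra leaf T.

Let B0_borel B : B0 B -> measurable (B : set (borel Y)).
Proof.
apply: generated_algebra_ind => {B} [[i|q]||A mA|A B mA mB|A mA].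
- by apply: sub_sigma_algebra; exact: baseb.1.
- apply: (@measurable_superlevel _ (borel Y)).
  by apply/measurable_EFinP; exact: measurable_int lstarL1.
- exact: measurable0.
- exact: measurableC.
- exact: measurableU.
- by have := measT measurableT mA; rewrite setTI.
Qed.

Let generic y := (forall B, B0 B ->
  n%:R^-1 * birkhoff_sum T \1_B n y @[n --> \oo] --> fine (nu B)) /\
  n%:R^-1 * birkhoff_sum T lstar n y @[n --> \oo] -->
  fine (\int[nu]_y (lstar y)%:E).

Let ae_generic : {ae nu, forall y : borel Y, generic y}.
Proof.
have genB : {ae nu, forall y : borel Y, forall B, B0 B ->
    n%:R^-1 * birkhoff_sum T \1_B n y @[n --> \oo] --> fine (nu B)}.
  pose G (t : GenTree.tree (nat + rat)) y :=
    n%:R^-1 * birkhoff_sum T \1_(algebra_set leaf T t) n y @[n --> \oo] -->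
    fine (nu (algebra_set leaf T t)).
  have GP t : {ae nu, forall y : borel Y, G t y}.
    have mt : measurable (algebra_set leaf T t : set (borel Y)).
      by apply: B0_borel; exists t.
    have := @ergodic_theorem _ (borel Y) R nu T \1_(algebra_set leaf T t)
      measT invT ergT (integrable_indic _ mt).
    by rewrite integral_indic// setIT.
  have : {ae nu, forall y : borel Y, forall i : nat,
      if unpickle i is Some t then G t y else True}.
    by apply: ae_foralln => i; case: unpickle => [t|]; [exact: GP|exact: aeW].
  apply: filterS => y Gy _ [t _ <-].
  by have := Gy (pickle t); rewrite pickleK.
apply: filterS2 genB (ergodic_theorem measT invT ergT lstarL1) => y.
by split.
Qed.

(** An error of [1] in the choice of the near minimiser of the Birkhoff sum
    vanishes in the average. *)
Let joining_below y (U : set_system nat) : generic y ->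
  UltraFilter U -> \oo `<=` U ->
  exists2 lam : probability (borel (X * Y)%type) R, joinings S T nu lam &
  forall a, (\forall n \near U, n%:R^-1 * infimal_sum S T l n y <= a) ->
    (\int[lam]_z (l z)%:E <= a%:E)%E.
Proof.
move=> [genB genl] uU ooU; have PU : ProperFilter U := ultra_proper.
have /choice[x xopt] n : exists x, birkhoff_sum (prod_map S T) l n (x, y) <
    infimal_sum S T l n y + 1.
  have [_ [x _ <-] ?] := inf_adherent ltr01 (has_inf_birkhoff_sum S T lbound n
    y).
  by exists x.
have [|||lam joinlam lamle] := @joining_of_orbit R X Y S T l lstar B0 b
  compactX contS measT open_l lbound (generated_algebra0 leaf T)
  (@generated_algebraU _ _ leaf T) (@generated_algebraC _ _ leaf T) B0_borel
  baseb _ _ _ nu lstarL1 x y U uU ooU genB genl.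
- by move=> i; exact: (generated_algebra_leaf leaf T (inl i)).
- by move=> B; exact: generated_algebra_preimage.
- by move=> q; exact: (generated_algebra_leaf leaf T (inr q)).
exists lam => // a ua; apply/lee_addgt0Pr => e e0; rewrite -EFinD.
apply: lamle; near=> n.
have -> : ergodic_average S T l n (x n) y =
    n%:R^-1 * birkhoff_sum (prod_map S T) l n (x n, y).
  by congr (_ * _); apply: eq_bigr => k _; rewrite iter_prod_map.
apply: (@le_trans _ _ (n%:R^-1 * (infimal_sum S T l n y + 1))).
  by rewrite ler_wpM2l ?invr_ge0// ltW.
rewrite mulrDr mulr1 lerD//; first by near: n.
near: n; apply: ooU.
have [m _ me] := near_infty_natSinv_lt (PosNum e0).
by exists m.+1 => // -[//|n] /= mn; exact/ltW/me.
Unshelve. all: end_near. Qed.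

Let L := inf_joinings S T nu l.

Let integral_joining_ge lam : joinings S T nu lam ->
  (- (\int[nu]_y (lstar y)%:E) <= \int[lam]_z (l z)%:E)%E.
Proof.
move=> joinlam.
have [intl intlstar <-] := integrable_joining open_l lbound lstarL1 joinlam.
rewrite -integralN; last exact: integrable_add_def.
apply: le_integral => //; first exact: (integrableN intlstar).
by move=> z _; rewrite -EFinN lee_fin; have := lbound z;
  rewrite ler_norml => /andP[].
Qed.

(** A generic point exists, so there is a joining; and every integral is at
    least minus the integral of [lstar]. *)
Lemma inf_joinings_fin_num : L \is a fin_num.
Proof.
have [y geny] := ae_exists ae_generic.
have [U [uU ooU]] := ultraFilterLemma (eventually_filter : ProperFilter \oo).
have [lam joinlam _] := joining_below geny uU ooU.
have [intl _ _] := integrable_joining open_l lbound lstarL1 joinlam.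
rewrite fin_numElt; apply/andP; split; last first.
  apply: (@le_lt_trans _ _ (\int[lam]_z (l z)%:E)%E);
    last exact: integrable_lty intl.
  by apply: ereal_inf_lbound; exists lam.
apply: (@lt_le_trans _ _ (- (\int[nu]_y (lstar y)%:E))%E).
  rewrite ltNye_eq fin_numN; apply/orP; left.
  exact: (integrable_fin_num _ lstarL1).
by apply: le_ereal_inf_tmp => _ [lam' joinlam' <-]; exact: integral_joining_ge.
Qed.

Let c := fine L.

Let ae_upper : {ae nu, forall y : borel Y, forall e, 0 < e ->
  \forall n \near \oo, n%:R^-1 * infimal_sum S T l n y <= c + e}.
Proof.
have : {ae nu, forall y : borel Y, forall k : nat, exists K, forall n,
    infimal_sum S T l n y <= n%:R * (c + k.+1%:R^-1) + K}.
  apply: ae_foralln => k.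
  have : (L < (c + k.+1%:R^-1)%:E)%E.
    by rewrite EFinD fineK ?inf_joinings_fin_num// lteDl ?inf_joinings_fin_num//
      lte_fin invr_gt0.
  move=> /ereal_inf_lt[_ [lam joinlam <-] lamlt].
  have [intl _ _] := integrable_joining open_l lbound lstarL1 joinlam.
  have mST : measurable_fun setT
      (prod_map S T : borel (X * Y)%type -> borel (X * Y)%type).
    exact: (measurable_prod_map baseb contS measT).
  apply: (@ae_linear_bound _ _ (borel (X * Y)%type) (borel Y) R lam nu
    (prod_map S T) T snd l (infimal_sum S T l) (fun y => - lstar y)) => //.
  - exact: joinlam.1.
  - exact: measurable_snd_borel.
  - exact: joinlam.2.
  - move=> n.
    exact: (measurable_infimal_sum compactX contS measT open_l lbound baseb).
  - by move=> n y; exact: infimal_sum_superadditive.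
  - by move=> n z; exact: infimal_sum_le.
by apply: filterS => y; exact: limsup_of_linear_bounds.
Qed.

(** If the averages fell below [c - e] at infinitely many times, an ultrafilter
    containing this set of times would give a joining with an integral below the
    infimum. *)
Let cvg_average y : generic y -> (forall e, 0 < e ->
    \forall n \near \oo, n%:R^-1 * infimal_sum S T l n y <= c + e) ->
  inf_average S T l n y @[n --> \oo] --> L.
Proof.
move=> geny upper; rewrite -[L]fineK ?inf_joinings_fin_num//.
rewrite (_ : (fun n => _) = fun n => (n%:R^-1 * infimal_sum S T l n y)%:E).
  apply: cvg_EFin; first exact: nearW.
  apply/cvgrPdist_le => e e0; near=> n.
  rewrite ler_distlC; apply/andP; split; near: n; last exact: upper.
  apply: contrapT => notlower.
  pose I := [set n | n%:R^-1 * infimal_sum S T l n y <= c - e].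
  pose G : set_system nat := filter_from [set: nat] (fun m =>
    I `&` [set n | (m <= n)%N]).
  have PG : ProperFilter G.
    apply: filter_from_proper; last first.
      move=> m _; apply: contrapT => /forallNP noI; apply: notlower.
      exists m => // n /= mn; rewrite leNgt; apply/negP => lt.
      by apply: (noI n); split => //; exact: ltW.
    apply: filter_from_filter; first by exists 0%N.
    move=> m p _ _; exists (maxn m p) => // n [In /=];
      rewrite geq_max => /andP[mn pn].
    by split; split.
  have [U [uU GU]] := ultraFilterLemma PG.
  have ooU : \oo `<=` U.
    move=> A [m _ mA]; apply: GU; exists m => // n [_ /= mn]; exact: mA.
  have [lam joinlam lamle] := joining_below geny uU ooU.
  have := lamle (c - e); rewrite leNgt => /(_ _)/negP; apply.
    by apply: GU; exists 0%N => // n [].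
  apply: (@lt_le_trans _ _ L); last by apply: ereal_inf_lbound; exists lam.
  rewrite -[ltRHS]fineK ?inf_joinings_fin_num// lte_fin.
  by rewrite ltrBlDr ltrDl.
by apply/funext => n; exact: inf_averageE.
Unshelve. all: end_near. Qed.

Lemma cvg_inf_average : {ae nu, forall y : borel Y,
  inf_average S T l n y @[n --> \oo] --> L}.
Proof.
apply: (@filterS2 (borel Y) _ _ generic _ _ _ ae_generic ae_upper) => y.
exact: cvg_average.
Qed.

(** For a generic [y] at which the upper bound holds, the joining obtained from
    any ultrafilter has integral at most [c + e] for all [e]. *)
Lemma optimal_joining : exists2 lam : probability (borel (X * Y)%type) R,
  joinings S T nu lam & (\int[lam]_z (l z)%:E)%E = L.
Proof.
have [y [geny upper]] : exists y, generic y /\ forall e, 0 < e ->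
    \forall n \near \oo, n%:R^-1 * infimal_sum S T l n y <= c + e.
  apply: (@ae_exists _ (borel Y) R nu).
  by apply: (@filterS2 (borel Y) _ _ generic _ _ _ ae_generic ae_upper) => y.
have [U [uU ooU]] := ultraFilterLemma (eventually_filter : ProperFilter \oo).
have [lam joinlam lamle] := joining_below geny uU ooU.
exists lam => //; apply/eqP; rewrite eq_le; apply/andP; split; last first.
  by apply: ereal_inf_lbound; exists lam.
rewrite -[leRHS]fineK ?inf_joinings_fin_num//; apply/lee_addgt0Pr => e e0.
by rewrite -EFinD; apply: lamle; apply: ooU; exact: upper.
Qed.

End optimal_joining.

Theorem theorem2p3 (R : realType)
  (Y : ptopologicalType) (T : Y -> Y) (nu : probability (borel Y) R)
  (X : pmetricType R) (S : X -> X)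
  (l : X * Y -> R) (lstar : Y -> R)
  (polishY : polish R Y)
  (measT : measurable_fun [set: borel Y] (T : borel Y -> borel Y))
  (invT : invariant_measure (T : borel Y -> borel Y) nu)
  (ergT : ergodic (T : borel Y -> borel Y) nu)
  (compactX : compact [set: X])
  (contS : continuous S)
  (lscl : lower_semicontinuous (fun z : X * Y => (l z)%:E))
  (lstarL1 : nu.-integrable [set: borel Y] (fun y : borel Y => (lstar y)%:E))
  (lbound : forall y : Y,
     (ereal_sup [set `|l (x, y)|%:E | x in [set: X]] <= (lstar y)%:E)%E) :
  [/\ {ae nu, forall y : borel Y,
        inf_average S T l n y @[n --> \oo] --> inf_joinings S T nu l},
      inf_joinings S T nu l \is a fin_num
    & exists2 lam : probability (borel (X * Y)%type) R,
        joinings S T nu lam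
        & (\int[lam]_z (l z)%:E)%E = inf_joinings S T nu l].

Proof.
have [b baseb] := polish_base polishY.
have open_l q : open [set z | q < l z].
  rewrite (_ : [set z | _] = [set z | q%:E < (l z)%:E]%E).
    by move/lower_semicontinuousP : lscl; exact.
  by apply/funext => z; rewrite /= lte_fin.
have lb z : `|l z| <= lstar z.2.
  rewrite -lee_fin; apply: le_trans (lbound z.2); apply: ereal_sup_ubound.
  by exists z.1 => //; case: z.
split.
- exact: (cvg_inf_average compactX contS measT invT ergT open_l lb lstarL1
  baseb).
- exact: (inf_joinings_fin_num compactX contS measT invT ergT open_l lb lstarL1
  baseb).
- exact: (optimal_joining compactX contS measT invT ergT open_l lb lstarL1
  baseb).
Qed.
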